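(* Let $\mathcal{C}$ and $\mathcal{D}$ be monoidal categories, let $(C,\Delta,\varepsilon,c)$ and $(D,\Delta',\varepsilon',c')$ be braided coalgebras in $\mathcal{C}$ and $\mathcal{D}$, respectively, and let $(F,\varphi_2,\varphi_0)\colon\mathcal{C}\to\mathcal{D}$ be a monoidal functor. Then the assignment $$\eta_\bullet\ \mapsto\ r'_{F(C)}\circ(F(C)\otimes\varphi_0^{-1})\circ(\varphi_2)_{C,I}^{-1}\circ(\eta_1)_{I}\circ(D\otimes\varphi_0)\circ r_D^{\prime\,-1}$$ induces a bijective correspondence between (i) collections $\eta_\bullet=\{\eta_n\colon\widetilde{\mathcal{T}}_n(D,c')\circ F\to F\circ\widetilde{\mathcal{T}}_n(C,c)\}_{n\ge0}$ of natural transformations such that the pair $(F,\eta_\bullet)$ is a relative morphism from $\widetilde{\mathcal{T}}_\bullet(C,c)$ to $\widetilde{\mathcal{T}}_\bullet(D,c')$, and $\eta_1=(\varphi_2)_{C,-}\circ(\alpha'\otimes F(-))$ for some morphism $\alpha'\colon D\to F(C)$ in $\mathcal{D}$; and (ii) morphisms $\alpha\colon D\to F(C)$ in $\mathcal{D}$ which satisfy the equalities $$\varphi_0\circ\varepsilon'=F(\varepsilon)\circ\alpha,\qquad(\varphi_2)_{C,C}\circ(\alpha\otimes\alpha)\circ\Delta'=F(\Delta)\circ\alpha,$$ $$(\varphi_2)_{C,C}\circ(\alpha\otimes\alpha)\circ c'=F(c)\circ(\varphi_2)_{C,C}\circ(\alpha\otimes\alpha).$$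
   Context: Conventions. Categories are locally small. A monoidal category has unit $I$, associator $a_{X,Y,Z}\colon(X\otimes Y)\otimes Z\to X\otimes(Y\otimes Z)$, and unitors $l_X\colon I\otimes X\to X$, $r_X\colon X\otimes I\to X$; those of $\mathcal{D}$ are written $a',l',r'$. An object also denotes its identity morphism in expressions such as $C\otimes f$. A monoidal functor $(F,\varphi_2,\varphi_0)$ is strong: $\varphi_0\colon I\to F(I)$ and $(\varphi_2)_{X,Y}\colon F(X)\otimes F(Y)\to F(X\otimes Y)$ are isomorphisms, natural and satisfying the usual coherence conditions. $\star$ denotes horizontal composition (whiskering) of natural transformations. For a category $\mathcal{C}$, $[\mathcal{C},\mathcal{C}]$ is the strict monoidal category of endofunctors, with $F\otimes G=F\circ G$, $\eta\otimes\theta=\eta\star\theta$, unit $\mathrm{id}_{\mathcal{C}}$. A strict monoidal functor preserves tensor products and unit on the nose. Braided coalgebra. A braided coalgebra $(C,\Delta,\varepsilon,c)$ in a monoidal category $\mathcal{C}$ consists of an object $C$, morphisms $\Delta\colon C\to C\otimes C$, $\varepsilon\colon C\to I$, and an isomorphism $c\colon C\otimes C\to C\otimes C$ such that, with $a=a_{C,C,C}$: $a\circ(\Delta\otimes C)\circ\Delta=(C\otimes\Delta)\circ\Delta$; $(\varepsilon\otimes C)\circ\Delta=l_C^{-1}$; $(C\otimes\varepsilon)\circ\Delta=r_C^{-1}$; $a\circ(c\otimes C)\circ a^{-1}\circ(C\otimes c)\circ a\circ(c\otimes C)=(C\otimes c)\circ a\circ(c\otimes C)\circ a^{-1}\circ(C\otimes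 c)\circ a$; $l_C\circ(\varepsilon\otimes C)\circ c=r_C\circ(C\otimes\varepsilon)$; $r_C\circ(C\otimes\varepsilon)\circ c=l_C\circ(\varepsilon\otimes C)$; $a\circ(\Delta\otimes C)\circ c=(C\otimes c)\circ a\circ(c\otimes C)\circ a^{-1}\circ(C\otimes\Delta)$; $a^{-1}\circ(C\otimes\Delta)\circ c=(c\otimes C)\circ a^{-1}\circ(C\otimes c)\circ a\circ(\Delta\otimes C)$. Augmented braided category. $(\mathbf{\Delta}\mathbf{B})_+$ has objects $\langle n\rangle$ ($n\ge0$) and morphisms generated by $\delta_j^n\colon\langle n\rangle\to\langle n+1\rangle$ ($0\le j\le n$), $\sigma_j^n\colon\langle n+2\rangle\to\langle n+1\rangle$ ($0\le j\le n$), $\tau_i^n,(\tau_i^n)^{-1}\colon\langle n+1\rangle\to\langle n+1\rangle$ ($1\le i\le n$), subject to: (1) $\delta_j^n\delta_i^{n-1}=\delta_i^n\delta_{j-1}^{n-1}$ for $0\le i<j\le n$; (2) $\sigma_j^n\sigma_i^{n+1}=\sigma_i^n\sigma_{j+1}^{n+1}$ for $0\le i\le j\le n$; (3) for $0\le i\le n+1$, $0\le j\le n$: $\sigma_j^n\delta_i^{n+1}$ equals $\delta_i^n\sigma_{j-1}^{n-1}$ if $i<j$, $\mathrm{id}$ if $i\in\{j,j+1\}$, $\delta_{i-1}^n\sigma_j^{n-1}$ if $i>j+1$; (4) $(\tau_i^n)^{-1}$ is inverse to $\tau_i^n$; (5) $\tau_i^n\tau_{i+1}^n\tau_i^n=\tau_{i+1}^n\tau_i^n\tau_{i+1}^n$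 for $1\le i<n$; (6) $\tau_i^n\tau_j^n=\tau_j^n\tau_i^n$ if $|i-j|\ge2$; (7) for $1\le i\le n$, $0\le j\le n$: $\tau_i^n\delta_j^n$ equals $\delta_j^n\tau_i^{n-1}$ if $i<j$, $\delta_{j-1}^n$ if $i=j$, $\delta_{j+1}^n$ if $i=j+1$, $\delta_j^n\tau_{i-1}^{n-1}$ if $i>j+1$; (8) for $1\le i\le n$, $0\le j\le n$: $\tau_i^n\sigma_j^n$ equals $\sigma_j^n\tau_i^{n+1}$ if $i<j$, $\sigma_{j-1}^n\tau_{j+1}^{n+1}\tau_j^{n+1}$ if $i=j$, $\sigma_{j+1}^n\tau_{j+1}^{n+1}\tau_{j+2}^{n+1}$ if $i=j+1$, $\sigma_j^n\tau_{i+1}^{n+1}$ if $i>j+1$. It is strict monoidal with unit $\langle0\rangle$, $\langle m\rangle\otimes\langle n\rangle=\langle m+n\rangle$, $\langle m\rangle\otimes\delta_j^n=\delta_{m+j}^{m+n}$, $\delta_j^n\otimes\langle m\rangle=\delta_j^{m+n}$, $\langle m\rangle\otimes\sigma_j^n=\sigma_{m+j}^{m+n}$, $\sigma_j^n\otimes\langle m\rangle=\sigma_j^{m+n}$, $\langle m\rangle\otimes\tau_i^n=\tau_{m+i}^{m+n}$, $\tau_i^n\otimes\langle m\rangle=\tau_i^{m+n}$. The functor $\widetilde{\mathcal{T}}_\bullet(C,c)$. For a braided coalgebra $(C,\Delta,\varepsilon,c)$ in $\mathcal{C}$, $\widetilde{\mathcal{T}}_\bullet(C,c)\colon(\mathbf{\Delta}\mathbf{B})_+^{\mathrm{op}}\to[\mathcal{C},\mathcal{C}]$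 denotes the unique strict monoidal functor, with value at $\langle n\rangle$ written $\widetilde{\mathcal{T}}_n(C,c)$, sending $\langle1\rangle$ to $C\otimes(-)$, $\delta_0^0$ to $l\circ(\varepsilon\otimes(-))$, $\sigma_0^0$ to $a_{C,C,-}\circ(\Delta\otimes(-))$, and $\tau_1^1$ to $a_{C,C,-}\circ(c\otimes(-))\circ a_{C,C,-}^{-1}$. Relative morphism. Let $\mathcal{X}_\bullet\colon(\mathbf{\Delta}\mathbf{B})_+^{\mathrm{op}}\to[\mathcal{C},\mathcal{C}]$ and $\mathcal{Y}_\bullet\colon(\mathbf{\Delta}\mathbf{B})_+^{\mathrm{op}}\to[\mathcal{D},\mathcal{D}]$ be strict monoidal functors, with values $\mathcal{X}_n,\mathcal{Y}_n$ at $\langle n\rangle$. A relative morphism from $\mathcal{X}_\bullet$ to $\mathcal{Y}_\bullet$ is a pair $(F,\eta_\bullet)$ of a functor $F\colon\mathcal{C}\to\mathcal{D}$ and natural transformations $\eta_n\colon\mathcal{Y}_n\circ F\to F\circ\mathcal{X}_n$ ($n\ge0$) such that for all $m,n\ge0$ and all morphisms $\phi\colon\langle m\rangle\to\langle n\rangle$ in $(\mathbf{\Delta}\mathbf{B})_+$: $\eta_m\circ(\mathcal{Y}(\phi)\star F)=(F\star\mathcal{X}(\phi))\circ\eta_n$; $\eta_0=\mathrm{id}_F$; $\eta_{m+n}=(\eta_m\star\mathcal{X}_n)\circ(\mathcal{Y}_m\star\eta_n)$. *)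

(* Defs.v *)
From mathcomp Require Import all_boot.
From mathcomp Require Import zify.
From mathcomp Require Import boolp classical_sets functions.

Set Implicit Arguments.
Unset Strict Implicit.
Unset Printing Implicit Defensive.

Declare Scope cat_scope.
Delimit Scope cat_scope with cat.
Local Open Scope cat_scope.

Record category := Category {
  ob : Type;
  hom : ob -> ob -> Type;
  idm : forall a, hom a a;
  comp : forall a b c, hom b c -> hom a b -> hom a c;
  compIl : forall a b (f : hom a b), comp (idm b) f = f;
  compIr : forall a b (f : hom a b), comp f (idm a) = f;
  compA : forall a b c d (h : hom c d) (g : hom b c) (f : hom a b),
    comp h (comp g f) = comp (comp h g) f }.

Coercion ob : category >-> Sortclass.
Arguments hom {_} _ _.
Arguments idm {_} a.
Arguments comp {_ a b c} g f.
Notation "g ∘ f" := (comp g f) (at level 40, left associativity) : cat_scope.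

(* Equality of arrows whose sources (and targets) are equal but possibly not
   convertible: [f ≡ g] holds iff the objects agree and f, g are the same
   arrow.  Used for equations that hold "on the nose". *)
Inductive hom_eq (C : category) (a b : C) (f : hom a b) :
    forall c d : C, hom c d -> Prop :=
  hom_eq_refl : @hom_eq C a b f a b f.
Notation "f ≡ g" := (hom_eq f g) (at level 70, no associativity) : cat_scope.

Section HomEq.
Variable C : category.

Lemma hom_eq_ob (a b c d : C) (f : hom a b) (g : hom c d) :
  f ≡ g -> a = c /\ b = d.
Proof. by case. Qed.

Lemma hom_eqE (a b : C) (f g : hom a b) : f ≡ g -> f = g.
Proof.
have cast c d (h : hom c d) : f ≡ h -> exists (e1 : a = c) (e2 : b = d),
    h = ecast x (hom x d) e1 (ecast y (hom a y) e2 f).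
  by case; exists erefl, erefl.
case/cast=> e1 [e2 ->].
by rewrite (Prop_irrelevance e1 erefl) (Prop_irrelevance e2 erefl).
Qed.

Lemma eq_hom_eq (a b : C) (f g : hom a b) : f = g -> f ≡ g.
Proof. by move->. Qed.

Lemma hom_eq_sym (a b c d : C) (f : hom a b) (g : hom c d) : f ≡ g -> g ≡ f.
Proof. by case. Qed.

Lemma hom_eq_trans (a b c d x y : C)
  (f : hom a b) (g : hom c d) (h : hom x y) : f ≡ g -> g ≡ h -> f ≡ h.
Proof. by move=> fg; case. Qed.

Lemma hom_eq_comp (a b c a' b' c' : C) (g : hom b c) (f : hom a b)
    (g' : hom b' c') (f' : hom a' b') :
  g ≡ g' -> f ≡ f' -> g ∘ f ≡ g' ∘ f'.
Proof.
move=> gg ff; have [? ?] := hom_eq_ob gg; have [? _] := hom_eq_ob ff.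
by subst; rewrite (hom_eqE gg) (hom_eqE ff).
Qed.

End HomEq.

Record iso (C : category) (a b : C) := Iso {
  iso_hom : hom a b;
  iso_inv : hom b a;
  iso_invK : iso_inv ∘ iso_hom = idm a;
  iso_homK : iso_hom ∘ iso_inv = idm b }.
Coercion iso_hom : iso >-> hom.
Notation "f ^-1" := (iso_inv f) : cat_scope.

Definition opp (C : category) : category :=
  @Category C (fun a b => @hom C b a) (@idm C)
    (fun a b c g f => f ∘ g)
    (fun a b f => compIr f) (fun a b f => compIl f)
    (fun a b c d h g f => esym (compA f g h)).

Lemma opp_hom_eq (C : category) (a b c d : C) (f : hom a b) (g : hom c d) :
  f ≡ g -> @hom_eq (opp C) b a f d c g.
Proof. by case. Qed.

Record functor (C D : category) := Functor {
  fobj : C -> D;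
  fmap : forall a b, hom a b -> hom (fobj a) (fobj b);
  fmapI : forall a, fmap (idm a) = idm (fobj a);
  fmapM : forall a b c (g : hom b c) (f : hom a b),
    fmap (g ∘ f) = fmap g ∘ fmap f }.
Coercion fobj : functor >-> Funclass.
Arguments fmap {C D} F {a b} f : rename.

Definition fid (C : category) : functor C C :=
  @Functor C C id (fun a b f => f) (fun a => erefl) (fun a b c g f => erefl).

Section FunctorComposition.
Variables (C D E : category) (G : functor D E) (F : functor C D).

Fact fcomp_id a : fmap G (fmap F (idm a)) = idm (G (F a)).
Proof. by rewrite !fmapI. Qed.

Fact fcomp_comp a b c (g : hom b c) (f : hom a b) :
  fmap G (fmap F (g ∘ f)) = fmap G (fmap F g) ∘ fmap G (fmap F f).
Proof. by rewrite !fmapM. Qed.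

Definition fcomp : functor C E :=
  @Functor C E (fun a => G (F a)) (fun a b f => fmap G (fmap F f))
    fcomp_id fcomp_comp.

End FunctorComposition.
Notation "G ⊚ F" := (fcomp G F) (at level 40, left associativity) : cat_scope.

Record nat_trans (C D : category) (F G : functor C D) := NatTrans {
  ncomp : forall a, hom (F a) (G a);
  ncomp_nat : forall a b (f : hom a b), ncomp b ∘ fmap F f = fmap G f ∘ ncomp a }.
Coercion ncomp : nat_trans >-> Funclass.
Notation "F ⟹ G" := (nat_trans F G) (at level 70, no associativity) : cat_scope.

Lemma nat_trans_eq (C D : category) (F G : functor C D) (s t : F ⟹ G) :
  (forall a, s a = t a) -> s = t.
Proof.
case: s t => [s sn] [t tn] /= st.
have e : s = t by exact: functional_extensionality_dep.
by subst t; congr NatTrans; exact: Prop_irrelevance.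
Qed.

Section NaturalTransformations.
Variables (C D : category).
Implicit Types F G H : functor C D.

Fact nid_nat F a b (f : hom a b) : idm (F b) ∘ fmap F f = fmap F f ∘ idm (F a).
Proof. by rewrite compIl compIr. Qed.

Definition nid F : F ⟹ F := NatTrans (@nid_nat F).

Fact nvcomp_nat F G H (t : G ⟹ H) (s : F ⟹ G) a b (f : hom a b) :
  (t b ∘ s b) ∘ fmap F f = fmap H f ∘ (t a ∘ s a).
Proof. by rewrite -compA ncomp_nat compA ncomp_nat compA. Qed.

Definition nvcomp F G H (t : G ⟹ H) (s : F ⟹ G) : F ⟹ H :=
  NatTrans (nvcomp_nat t s).

Definition functor_cat : category.
Proof.
refine (@Category (functor C D) (@nat_trans C D) nid nvcomp _ _ _).
- by move=> F G s; apply: nat_trans_eq => a /=; exact: compIl.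
- by move=> F G s; apply: nat_trans_eq => a /=; exact: compIr.
- by move=> F G H K u t s; apply: nat_trans_eq => a /=; exact: compA.
Defined.

End NaturalTransformations.

Section HorizontalComposition.
Variables (C D E : category) (G G' : functor D E) (F F' : functor C D).
Variables (t : G ⟹ G') (s : F ⟹ F').

Fact nhcomp_nat a b (f : hom a b) :
  (t (F' b) ∘ fmap G (s b)) ∘ fmap (G ⊚ F) f
  = fmap (G' ⊚ F') f ∘ (t (F' a) ∘ fmap G (s a)).
Proof.
by rewrite -[LHS]compA /= -fmapM (ncomp_nat s) fmapM compA (ncomp_nat t) compA.
Qed.

Definition nhcomp : G ⊚ F ⟹ G' ⊚ F' :=
  @NatTrans C E (G ⊚ F) (G' ⊚ F') _ nhcomp_nat.

End HorizontalComposition.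
Notation "t ⋆ s" := (nhcomp t s) (at level 40, left associativity) : cat_scope.

Record strict_monoidal := StrictMonoidal {
  smcat : category;
  smtens : smcat -> smcat -> smcat;
  smtensm : forall a a' b b' : smcat,
    hom a a' -> hom b b' -> hom (smtens a b) (smtens a' b');
  smunit : smcat;
  smtens_id : forall a b, smtensm (idm a) (idm b) = idm (smtens a b);
  smtens_comp : forall a a' a'' b b' b'' (f' : hom a' a'') (f : hom a a')
      (g' : hom b' b'') (g : hom b b'),
    smtensm (f' ∘ f) (g' ∘ g) = smtensm f' g' ∘ smtensm f g;
  smtensA : forall a b c, smtens (smtens a b) c = smtens a (smtens b c);
  smtensIl : forall a, smtens smunit a = a;
  smtensIr : forall a, smtens a smunit = a;
  smtensmA : forall a a' b b' c c' (f : hom a a') (g : hom b b') (h : hom c c'),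
    smtensm (smtensm f g) h ≡ smtensm f (smtensm g h);
  smtensmIl : forall a a' (f : hom a a'), smtensm (idm smunit) f ≡ f;
  smtensmIr : forall a a' (f : hom a a'), smtensm f (idm smunit) ≡ f }.
Coercion smcat : strict_monoidal >-> category.
Arguments smtens {_} a b.
Arguments smtensm {_ a a' b b'} f g.
Arguments smunit {_}.

Definition sopp (M : strict_monoidal) : strict_monoidal.
Proof.
refine (@StrictMonoidal (opp M) (@smtens M)
  (fun a a' b b' f g => @smtensm M a' a b' b f g) (@smunit M) _ _ _ _ _ _ _ _).
- exact: smtens_id.
- by move=> *; exact: smtens_comp.
- exact: smtensA.
- exact: smtensIl.
- exact: smtensIr.
- by move=> *; exact/opp_hom_eq/smtensmA.
- by move=> *; exact/opp_hom_eq/smtensmIl.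
- by move=> *; exact/opp_hom_eq/smtensmIr.
Defined.

Lemma functor_eq (C D : category) (F G : functor C D) :
  (forall a, F a = G a) -> (forall a b (f : hom a b), fmap F f ≡ fmap G f) ->
  F = G.
Proof.
case: F G => [F Fm FI FM] [G Gm GI GM] /= FG.
have e : F = G by exact: functional_extensionality_dep.
subst G => em.
have {}em : Fm = Gm.
  apply: functional_extensionality_dep => a.
  apply: functional_extensionality_dep => b.
  by apply: functional_extensionality_dep => f; exact/hom_eqE.
by subst Gm; congr Functor; exact: Prop_irrelevance.
Qed.

Lemma nat_trans_hom_eq (C D : category) (F G F' G' : functor C D)
    (s : F ⟹ G) (t : F' ⟹ G') : F = F' -> G = G' ->
  (forall a, s a ≡ t a) -> @hom_eq (functor_cat C D) F G s F' G' t.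
Proof.
move=> ? ?; subst F' G' => st; apply/eq_hom_eq/nat_trans_eq => a.
exact/hom_eqE.
Qed.

Definition endo (C : category) : strict_monoidal.
Proof.
refine (@StrictMonoidal (functor_cat C C) (@fcomp C C C)
  (fun F F' G G' s t => s ⋆ t) (fid C) _ _ _ _ _ _ _ _).
- by move=> F G; apply: nat_trans_eq => a /=; rewrite fmapI compIl.
- move=> F F' F'' G G' G'' s' s t' t; apply: nat_trans_eq => a /=.
  by rewrite fmapM !compA -(compA (s' _) (fmap F' _)) -ncomp_nat !compA.
- by move=> F G H; exact: functor_eq.
- by move=> F; exact: functor_eq.
- by move=> F; exact: functor_eq.
- move=> F F' G G' H H' s t u; apply: nat_trans_hom_eq => [||a /=].
  + exact: functor_eq.
  + exact: functor_eq.
  + by rewrite fmapM compA.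
- move=> F F' s; apply: nat_trans_hom_eq => [||a /=]; try exact: functor_eq.
  by rewrite compIl.
- move=> F F' s; apply: nat_trans_hom_eq => [||a /=]; try exact: functor_eq.
  by rewrite fmapI compIr.
Defined.

Record strict_monoidal_functor (M N : strict_monoidal) := StrictMonoidalFunctor {
  smfun : functor M N;
  smfun_tens : forall a b : M, smfun (smtens a b) = smtens (smfun a) (smfun b);
  smfun_unit : smfun smunit = smunit;
  smfun_tensm : forall (a a' b b' : M) (f : hom a a') (g : hom b b'),
    fmap smfun (smtensm f g) ≡ smtensm (fmap smfun f) (fmap smfun g) }.
Coercion smfun : strict_monoidal_functor >-> functor.

(* The generators δ_j^n, σ_j^n, τ_i^n and (τ_i^n)^-1. *)
Inductive gen :=
  | dlt of nat & nat | sgm of nat & nat | tau of nat & nat | taui of nat & nat.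

Definition gvalid (g : gen) : bool :=
  match g with
  | dlt n j | sgm n j => j <= n
  | tau n i | taui n i => 0 < i <= n
  end.

Definition gsrc (g : gen) : nat :=
  match g with
  | dlt n _ => n | sgm n _ => n.+2 | tau n _ | taui n _ => n.+1
  end.

Definition gtgt (g : gen) : nat :=
  match g with dlt n _ | sgm n _ | tau n _ | taui n _ => n.+1 end.

(* [:: g1; ...; gk] stands for the composite g1 ∘ ... ∘ gk;
   [wf m n w] says that it is a well-formed composite from ⟨m⟩ to ⟨n⟩. *)
Fixpoint wf (m n : nat) (w : seq gen) : bool :=
  if w is g :: w' then [&& gvalid g, gtgt g == n & wf m (gsrc g) w']
  else m == n.

Inductive brel : seq gen -> seq gen -> Prop :=
  | rel_dd n i j : i < j <= n ->
      brel [:: dlt n j; dlt n.-1 i] [:: dlt n i; dlt n.-1 j.-1]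
  | rel_ss n i j : i <= j <= n ->
      brel [:: sgm n j; sgm n.+1 i] [:: sgm n i; sgm n.+1 j.+1]
  | rel_sd_lt n i j : i < j <= n ->
      brel [:: sgm n j; dlt n.+1 i] [:: dlt n i; sgm n.-1 j.-1]
  | rel_sd_eq n i j : j <= n -> (i == j) || (i == j.+1) ->
      brel [:: sgm n j; dlt n.+1 i] [::]
  | rel_sd_gt n i j : j.+1 < i <= n.+1 ->
      brel [:: sgm n j; dlt n.+1 i] [:: dlt n i.-1; sgm n.-1 j]
  | rel_tauK n i : 0 < i <= n -> brel [:: taui n i; tau n i] [::]
  | rel_tauiK n i : 0 < i <= n -> brel [:: tau n i; taui n i] [::]
  | rel_yb n i : 0 < i < n ->
      brel [:: tau n i; tau n i.+1; tau n i] [:: tau n i.+1; tau n i; tau n i.+1]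
  | rel_tt n i j : 0 < i <= n -> 0 < j <= n -> (i.+1 < j) || (j.+1 < i) ->
      brel [:: tau n i; tau n j] [:: tau n j; tau n i]
  | rel_td_lt n i j : 0 < i -> i < j <= n ->
      brel [:: tau n i; dlt n j] [:: dlt n j; tau n.-1 i]
  | rel_td_eq n i : 0 < i <= n ->
      brel [:: tau n i; dlt n i] [:: dlt n i.-1]
  | rel_td_eqS n j : j.+1 <= n ->
      brel [:: tau n j.+1; dlt n j] [:: dlt n j.+1]
  | rel_td_gt n i j : j.+1 < i <= n ->
      brel [:: tau n i; dlt n j] [:: dlt n j; tau n.-1 i.-1]
  | rel_ts_lt n i j : 0 < i -> i < j <= n ->
      brel [:: tau n i; sgm n j] [:: sgm n j; tau n.+1 i]
  | rel_ts_eq n i : 0 < i <= n ->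
      brel [:: tau n i; sgm n i] [:: sgm n i.-1; tau n.+1 i.+1; tau n.+1 i]
  | rel_ts_eqS n j : j.+1 <= n ->
      brel [:: tau n j.+1; sgm n j] [:: sgm n j.+1; tau n.+1 j.+1; tau n.+1 j.+2]
  | rel_ts_gt n i j : j.+1 < i <= n ->
      brel [:: tau n i; sgm n j] [:: sgm n j; tau n.+1 i.+1].

(* The congruence generated by [brel] on well-formed words from ⟨m⟩ to ⟨n⟩;
   ill-formed words never occur in a chain of rewritings. *)
Inductive beq (m n : nat) : seq gen -> seq gen -> Prop :=
  | beq_step u v l r : brel l r -> wf m n (u ++ l ++ v) ->
      wf m n (u ++ r ++ v) -> beq m n (u ++ l ++ v) (u ++ r ++ v)
  | beq_refl w : wf m n w -> beq m n w w
  | beq_sym w w' : beq m n w w' -> beq m n w' w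
  | beq_trans w w' w'' : beq m n w w' -> beq m n w' w'' -> beq m n w w''.

(* Morphisms ⟨m⟩ -> ⟨n⟩: equivalence classes of words, as predicates. *)
Definition bhom (m n : nat) : Type :=
  {P : seq gen -> Prop | exists2 w, wf m n w & P = beq m n w}.

Definition bcls (m n : nat) (w : seq gen) (h : wf m n w) : bhom m n :=
  exist _ (beq m n w) (ex_intro2 _ _ w h erefl).

Definition brepr (m n : nat) (f : bhom m n) : seq gen := s2val (cid2 (svalP f)).

Lemma brepr_wf m n (f : bhom m n) : wf m n (brepr f).
Proof. exact: (s2valP (cid2 (svalP f))). Qed.

Lemma breprK m n (f : bhom m n) : bcls (brepr_wf f) = f.
Proof.
have e : beq m n (brepr f) = sval f by rewrite /brepr; case: cid2.
by case: f e => P hP e; exact: eq_exist.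
Qed.

Lemma bcls_eq m n w w' (h : wf m n w) (h' : wf m n w') :
  bcls h = bcls h' <-> beq m n w w'.
Proof.
split=> [[e]|e]; first by rewrite e; exact: beq_refl.
apply: eq_exist; apply: funext => v; apply: propext; split.
- exact/beq_trans/beq_sym.
- exact: beq_trans.
Qed.

Lemma bclsK m n w (h : wf m n w) : beq m n (brepr (bcls h)) w.
Proof. by apply/(bcls_eq (brepr_wf _) h); rewrite breprK. Qed.

Lemma bcls_ind m n (P : bhom m n -> Prop) :
  (forall w (h : wf m n w), P (bcls h)) -> forall f, P f.
Proof. by move=> Pc f; rewrite -(breprK f). Qed.

Lemma beq_wf m n w w' : beq m n w w' -> wf m n w /\ wf m n w'.
Proof.
by elim=> // [{}w {}w' _ [? ?]|w1 w2 w3 _ [? _] _ [_ ?]].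
Qed.

Lemma wf_cat m p n u v : wf p n u -> wf m p v -> wf m n (u ++ v).
Proof.
elim: u n => [n /eqP-> //|g u IH n /= /and3P[-> -> hu] hv] /=.
exact: IH.
Qed.

Lemma wf_catP m n u v : wf m n (u ++ v) -> exists2 p, wf p n u & wf m p v.
Proof.
elim: u n => [n /= h|g u IH n /= /and3P[-> -> /IH [p hu hv]]]; first by exists n.
by exists p.
Qed.

Lemma beq_cat m p n u u' v v' :
  beq p n u u' -> beq m p v v' -> beq m n (u ++ v) (u' ++ v').
Proof.
move=> uu' vv'; apply: (@beq_trans _ _ _ (u' ++ v)).
- have [hv _] := beq_wf vv'.
  elim: uu' => [x y l r lr hl hr|w hw|w w' _|w w' w'' _ IH _].
  + have := wf_cat hr hv; have := wf_cat hl hv.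
    by rewrite -!catA => *; exact: beq_step.
  + exact/beq_refl/(wf_cat hw).
  + exact: beq_sym.
  + exact: beq_trans.
- have [_ hu] := beq_wf uu'.
  elim: vv' => [x y l r lr hl hr|w hw|w w' _|w w' w'' _ IH _].
  + have := wf_cat hu hr; have := wf_cat hu hl.
    by rewrite !(catA u') => *; exact: beq_step.
  + exact/beq_refl/(wf_cat hu).
  + exact: beq_sym.
  + exact: beq_trans.
Qed.

Lemma wf_nil n : wf n n [::]. Proof. exact: eqxx. Qed.

Definition bid (n : nat) : bhom n n := bcls (wf_nil n).

Definition bcomp (m p n : nat) (g : bhom p n) (f : bhom m p) : bhom m n :=
  bcls (wf_cat (brepr_wf g) (brepr_wf f)).

Lemma bcompE m p n u v (hu : wf p n u) (hv : wf m p v) :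
  bcomp (bcls hu) (bcls hv) = bcls (wf_cat hu hv).
Proof. by apply/bcls_eq/beq_cat; exact: bclsK. Qed.

Lemma bcls_congr m n w w' (h : wf m n w) (h' : wf m n w') :
  w = w' -> bcls h = bcls h'.
Proof. by move=> e; subst w'; congr bcls; exact: Prop_irrelevance. Qed.

Definition DeltaB_cat : category.
Proof.
refine (@Category nat bhom bid bcomp _ _ _).
- by move=> a b; elim/bcls_ind=> w h; rewrite bcompE; exact: bcls_congr.
- move=> a b; elim/bcls_ind=> w h; rewrite bcompE; apply: bcls_congr.
  exact: cats0.
- move=> a b c d.
  elim/bcls_ind=> w h; elim/bcls_ind=> w' h'; elim/bcls_ind=> w'' h''.
  by rewrite !bcompE; apply: bcls_congr; rewrite catA.
Defined.

(* ⟨k⟩ ⊗ g and g ⊗ ⟨k⟩ for a generator g. *)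
Definition shl (k : nat) (g : gen) : gen :=
  match g with
  | dlt n j => dlt (k + n) (k + j)
  | sgm n j => sgm (k + n) (k + j)
  | tau n i => tau (k + n) (k + i)
  | taui n i => taui (k + n) (k + i)
  end.

Definition shr (k : nat) (g : gen) : gen :=
  match g with
  | dlt n j => dlt (n + k) j
  | sgm n j => sgm (n + k) j
  | tau n i => tau (n + k) i
  | taui n i => taui (n + k) i
  end.

Lemma brel_eq l r l' r' : brel l r -> l = l' -> r = r' -> brel l' r'.
Proof. by move=> lr <- <-. Qed.

Ltac brel_solve R :=
  apply: brel_eq; [apply: R; lia | rewrite /=; repeat f_equal; lia
                                 | rewrite /=; repeat f_equal; lia].

Lemma brel_shl k l r : brel l r -> brel (map (shl k) l) (map (shl k) r).
Proof.
case=> /=.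
- by move=> n i j h; brel_solve (@rel_dd (k + n) (k + i) (k + j)).
- by move=> n i j h; brel_solve (@rel_ss (k + n) (k + i) (k + j)).
- by move=> n i j h; brel_solve (@rel_sd_lt (k + n) (k + i) (k + j)).
- by move=> n i j h h'; brel_solve (@rel_sd_eq (k + n) (k + i) (k + j)).
- by move=> n i j h; brel_solve (@rel_sd_gt (k + n) (k + i) (k + j)).
- by move=> n i h; brel_solve (@rel_tauK (k + n) (k + i)).
- by move=> n i h; brel_solve (@rel_tauiK (k + n) (k + i)).
- by move=> n i h; brel_solve (@rel_yb (k + n) (k + i)).
- by move=> n i j h h' h''; brel_solve (@rel_tt (k + n) (k + i) (k + j)).
- by move=> n i j h h'; brel_solve (@rel_td_lt (k + n) (k + i) (k + j)).
- by move=> n i h; brel_solve (@rel_td_eq (k + n) (k + i)).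
- by move=> n j h; brel_solve (@rel_td_eqS (k + n) (k + j)).
- by move=> n i j h; brel_solve (@rel_td_gt (k + n) (k + i) (k + j)).
- by move=> n i j h h'; brel_solve (@rel_ts_lt (k + n) (k + i) (k + j)).
- by move=> n i h; brel_solve (@rel_ts_eq (k + n) (k + i)).
- by move=> n j h; brel_solve (@rel_ts_eqS (k + n) (k + j)).
- by move=> n i j h; brel_solve (@rel_ts_gt (k + n) (k + i) (k + j)).
Qed.

Lemma brel_shr k l r : brel l r -> brel (map (shr k) l) (map (shr k) r).
Proof.
case=> /=.
- by move=> n i j h; brel_solve (@rel_dd (n + k) i j).
- by move=> n i j h; brel_solve (@rel_ss (n + k) i j).
- by move=> n i j h; brel_solve (@rel_sd_lt (n + k) i j).
- by move=> n i j h h'; brel_solve (@rel_sd_eq (n + k) i j).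
- by move=> n i j h; brel_solve (@rel_sd_gt (n + k) i j).
- by move=> n i h; brel_solve (@rel_tauK (n + k) i).
- by move=> n i h; brel_solve (@rel_tauiK (n + k) i).
- by move=> n i h; brel_solve (@rel_yb (n + k) i).
- by move=> n i j h h' h''; brel_solve (@rel_tt (n + k) i j).
- by move=> n i j h h'; brel_solve (@rel_td_lt (n + k) i j).
- by move=> n i h; brel_solve (@rel_td_eq (n + k) i).
- by move=> n j h; brel_solve (@rel_td_eqS (n + k) j).
- by move=> n i j h; brel_solve (@rel_td_gt (n + k) i j).
- by move=> n i j h h'; brel_solve (@rel_ts_lt (n + k) i j).
- by move=> n i h; brel_solve (@rel_ts_eq (n + k) i).
- by move=> n j h; brel_solve (@rel_ts_eqS (n + k) j).
- by move=> n i j h; brel_solve (@rel_ts_gt (n + k) i j).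
Qed.

Lemma wf_shl k m n w : wf m n w -> wf (k + m) (k + n) (map (shl k) w).
Proof.
elim: w n => [n /eqP-> //=|g w IH n /= /and3P[hg /eqP<- /IH]].
by case: g hg => a b /= hg h; apply/and3P; split;
  rewrite ?addnS // -?addnS ?leq_add2l //; lia.
Qed.

Lemma wf_shr k m n w : wf m n w -> wf (m + k) (n + k) (map (shr k) w).
Proof.
elim: w n => [n /eqP-> //=|g w IH n /= /and3P[hg /eqP<- /IH]].
by case: g hg => a b /= hg h; apply/and3P; split => //; lia.
Qed.

Lemma beq_map (f : gen -> gen) (o : nat -> nat) m n w w' :
  (forall l r, brel l r -> brel (map f l) (map f r)) ->
  (forall u, wf m n u -> wf (o m) (o n) (map f u)) ->
  beq m n w w' -> beq (o m) (o n) (map f w) (map f w').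
Proof.
move=> hf ho; elim=> [u v l r lr /ho hl /ho hr|x /ho hx|x y _|x y z _ + _].
- by move: hl hr; rewrite !map_cat => hl hr; apply: beq_step => //; exact: hf.
- exact: beq_refl.
- exact: beq_sym.
- exact: beq_trans.
Qed.

Lemma beq_shl k m n w w' : beq m n w w' ->
  beq (k + m) (k + n) (map (shl k) w) (map (shl k) w').
Proof. by apply: beq_map; [exact: brel_shl | exact: wf_shl]. Qed.

Lemma beq_shr k m n w w' : beq m n w w' ->
  beq (m + k) (n + k) (map (shr k) w) (map (shr k) w').
Proof.
by apply: (@beq_map _ (addn^~ k)); [exact: brel_shr | exact: wf_shr].
Qed.

Definition wtens (m n' : nat) (u v : seq gen) : seq gen :=
  map (shr n') u ++ map (shl m) v.

Lemma wf_tens m m' n n' u v :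
  wf m m' u -> wf n n' v -> wf (m + n) (m' + n') (wtens m n' u v).
Proof.
move=> hu hv; apply: (@wf_cat _ (m + n')); [exact: wf_shr | exact: wf_shl].
Qed.

(* f ⊗ g := (f ⊗ ⟨n'⟩) ∘ (⟨m⟩ ⊗ g). *)
Definition btens m m' n n' (f : bhom m m') (g : bhom n n') :
    bhom (m + n) (m' + n') :=
  bcls (wf_tens (brepr_wf f) (brepr_wf g)).

Lemma beq_tens m m' n n' u u' v v' : beq m m' u u' -> beq n n' v v' ->
  beq (m + n) (m' + n') (wtens m n' u v) (wtens m n' u' v').
Proof.
by move=> hu hv; apply: (@beq_cat _ (m + n')); [exact: beq_shr | exact: beq_shl].
Qed.

Lemma btensE m m' n n' u v (hu : wf m m' u) (hv : wf n n' v) :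
  btens (bcls hu) (bcls hv) = bcls (wf_tens hu hv).
Proof. by apply/bcls_eq/beq_tens; exact: bclsK. Qed.

Lemma beq_brel m n l r : brel l r -> wf m n l -> wf m n r -> beq m n l r.
Proof.
move=> lr hl hr; have := @beq_step m n [::] [::] l r lr.
by rewrite /= !cats0; apply.
Qed.

(* Conjugating a commutation by the inverse of a τ. *)
Lemma beq_inv m n t t' ti ti' g :
  beq n n [:: ti; t] [::] -> beq m m [:: t'; ti'] [::] ->
  wf n n [:: ti] -> wf m m [:: ti'] ->
  beq m n [:: t; g] [:: g; t'] -> beq m n [:: g; ti'] [:: ti; g].
Proof.
move=> K K' hti hti' e.
have [/= ht hg] := beq_wf e.
have hgg : wf m n [:: g].
  move: (ht) hg => /= /and3P[_ _ /and3P[a b c]] /and3P[_ b' _].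
  by rewrite a b' /=; move: c.
apply: (@beq_trans _ _ _ ([:: ti] ++ ([:: t; g] ++ [:: ti']))).
  apply: beq_sym; apply: (@beq_cat _ n _ [:: ti; t] [::] [:: g; ti']) => //.
  apply: beq_refl; exact: (@wf_cat _ m _ [:: g] [:: ti']).
apply: (@beq_trans _ _ _ ([:: ti] ++ ([:: g; t'] ++ [:: ti']))).
  apply: (@beq_cat _ n); first exact: beq_refl.
  apply: (@beq_cat _ m) => //; exact: beq_refl.
rewrite -[[:: ti; g]]cats0.
apply: (@beq_cat _ m _ [:: ti; g] [:: ti; g] [:: t'; ti']) => //.
by apply: beq_refl; apply: (@wf_cat _ n _ [:: ti] [:: g]).
Qed.

Definition bswap g h : Prop :=
  beq (gsrc g + gsrc h) (gtgt g + gtgt h)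
    [:: shr (gtgt h) g; shl (gsrc g) h] [:: shl (gtgt g) h; shr (gsrc h) g].

Lemma wf_gen g : gvalid g -> wf (gsrc g) (gtgt g) [:: g].
Proof. by move=> /= ->; rewrite !eqxx. Qed.

Lemma bswap_brel g h : gvalid g -> gvalid h ->
  let l := [:: shr (gtgt h) g; shl (gsrc g) h] in
  let r := [:: shl (gtgt g) h; shr (gsrc h) g] in
  brel l r \/ brel r l -> bswap g h.
Proof.
move=> /wf_gen hg /wf_gen hh l r lr.
have hl : wf (gsrc g + gsrc h) (gtgt g + gtgt h) l.
  exact: (wf_cat (wf_shr _ hg) (wf_shl _ hh)).
have hr : wf (gsrc g + gsrc h) (gtgt g + gtgt h) r.
  exact: (wf_cat (wf_shl _ hh) (wf_shr _ hg)).
by case: lr => lr; [|apply: beq_sym]; exact: beq_brel.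
Qed.

Definition is_taui g := if g is taui _ _ then true else false.

Lemma bswap_pos g h : gvalid g -> gvalid h -> ~~ is_taui g -> ~~ is_taui h ->
  bswap g h.
Proof.
move=> vg vh pg ph; apply: bswap_brel => //.
case: g h vg vh pg ph => [a i|a i|a i|//] [b j|b j|b j|//] /= vg vh _ _.
- by right; brel_solve (@rel_dd (a + b).+1 i (a.+1 + j)).
- by right; brel_solve (@rel_sd_lt (a + b).+1 i (a.+1 + j)).
- by right; brel_solve (@rel_td_gt (a + b).+1 (a.+1 + j) i).
- by left; brel_solve (@rel_sd_gt (a + b).+1 (a.+2 + j) i).
- by right; brel_solve (@rel_ss (a + b).+1 i (a.+1 + j)).
- by right; brel_solve (@rel_ts_gt (a + b).+1 (a.+1 + j) i).
- by left; brel_solve (@rel_td_lt (a + b).+1 i (a.+1 + j)).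
- by left; brel_solve (@rel_ts_lt (a + b).+1 i (a.+1 + j)).
- by left; brel_solve (@rel_tt (a + b).+1 i (a.+1 + j)).
Qed.

Lemma beq_tauK n i : 0 < i <= n -> beq n.+1 n.+1 [:: taui n i; tau n i] [::].
Proof. by move=> h; apply: beq_brel; rewrite /= ?h ?eqxx //; exact: rel_tauK. Qed.

Lemma beq_tauiK n i : 0 < i <= n -> beq n.+1 n.+1 [:: tau n i; taui n i] [::].
Proof. by move=> h; apply: beq_brel; rewrite /= ?h ?eqxx //; exact: rel_tauiK. Qed.

Lemma bswap_taui_r g b j : gvalid g -> 0 < j <= b ->
  bswap g (tau b j) -> bswap g (taui b j).
Proof.
move=> vg vj; rewrite /bswap => e.
refine (beq_inv _ _ _ _ (beq_sym e)).
- exact: (beq_shl (gtgt g) (beq_tauK vj)).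
- exact: (beq_shl (gsrc g) (beq_tauiK vj)).
- by apply: (wf_shl _ (@wf_gen (taui b j) _)).
- by apply: (wf_shl _ (@wf_gen (taui b j) _)).
Qed.

Lemma bswap_taui_l h b j : gvalid h -> 0 < j <= b ->
  bswap (tau b j) h -> bswap (taui b j) h.
Proof.
move=> vg vj; rewrite /bswap => e; apply: beq_sym.
refine (beq_inv _ _ _ _ e).
- exact: (beq_shr (gtgt h) (beq_tauK vj)).
- exact: (beq_shr (gsrc h) (beq_tauiK vj)).
- by apply: (wf_shr _ (@wf_gen (taui b j) _)).
- by apply: (wf_shr _ (@wf_gen (taui b j) _)).
Qed.

Lemma bswap_gen g h : gvalid g -> gvalid h -> bswap g h.
Proof.
move=> vg vh.
have pos_l k : gvalid k -> ~~ is_taui k -> bswap k h.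
  move=> vk pk; case: h vh => [b j|b j|b j|b j] vh; try exact: bswap_pos.
  by apply: bswap_taui_r => //; exact: bswap_pos.
case: g vg => [b j|b j|b j|b j] vg; try exact: pos_l.
by apply: bswap_taui_l => //; exact: pos_l.
Qed.

Lemma beq_swap m m' n n' u v : wf m m' u -> wf n n' v ->
  beq (m + n) (m' + n')
    (map (shr n') u ++ map (shl m) v) (map (shl m') v ++ map (shr n) u).
Proof.
have swap1 g p p' w : gvalid g -> wf p p' w -> beq (gsrc g + p) (gtgt g + p')
    (shr p' g :: map (shl (gsrc g)) w) (map (shl (gtgt g)) w ++ [:: shr p g]).
  move=> vg; elim: w p' => [p' /eqP <-|h w IH p' /= /and3P[vh /eqP<- hw]] /=.
    by apply: beq_refl; exact: (wf_shr _ (wf_gen vg)).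
  apply: (@beq_trans _ _ _
    ([:: shl (gtgt g) h] ++ shr (gsrc h) g :: map (shl (gsrc g)) w)).
    apply: (@beq_cat _ (gsrc g + gsrc h) _ [:: shr (gtgt h) g; shl (gsrc g) h]
      [:: shl (gtgt g) h; shr (gsrc h) g]); first exact: bswap_gen.
    by apply: beq_refl; exact: wf_shl.
  apply: (@beq_cat _ (gtgt g + gsrc h) _ [:: shl (gtgt g) h] [:: shl (gtgt g) h]); last exact: IH.
  by apply: beq_refl; exact: (wf_shl _ (wf_gen vh)).
elim: u m' => [m' /eqP<- hv|g u IH m' /= /and3P[vg /eqP<- hu] hv] /=.
  by rewrite cats0; apply: beq_refl; exact: wf_shl.
apply: (@beq_trans _ _ _
  ([:: shr n' g] ++ (map (shl (gsrc g)) v ++ map (shr n) u))).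
  apply: (@beq_cat _ (gsrc g + n') _ [:: shr n' g] [:: shr n' g]); last exact: IH.
  by apply: beq_refl; exact: (wf_shr _ (wf_gen vg)).
rewrite -(cat1s (shr n g)) (catA (map _ v)).
apply: (@beq_cat _ (gsrc g + n) _ (shr n' g :: map (shl (gsrc g)) v)
  (map (shl (gtgt g)) v ++ [:: shr n g]));
  first exact: swap1.
by apply: beq_refl; exact: wf_shr.
Qed.

Lemma bcls_hom_eq m m' n n' u v (hu : wf m n u) (hv : wf m' n' v) :
  m = m' -> n = n' -> u = v ->
  @hom_eq DeltaB_cat m n (bcls hu) m' n' (bcls hv).
Proof. by move=> ? ? ?; subst; apply: eq_hom_eq; exact: bcls_congr. Qed.

Definition DeltaB : strict_monoidal.
Proof.
refine (@StrictMonoidal DeltaB_cat addn btens 0 _ _ _ _ _ _ _ _).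
- move=> a b; rewrite /= btensE; exact: bcls_congr.
- move=> a a' a'' b b' b''.
  elim/bcls_ind=> u' hu'; elim/bcls_ind=> u hu.
  elim/bcls_ind=> v' hv'; elim/bcls_ind=> v hv.
  rewrite /= !(bcompE, btensE); apply/bcls_eq.
  rewrite /wtens !map_cat -!catA.
  apply: (@beq_cat _ (a' + b'')); first exact/beq_refl/wf_shr.
  rewrite !catA; apply: (@beq_cat _ (a + b')); last exact/beq_refl/wf_shl.
  exact: beq_swap.
- by move=> a b c; exact/esym/addnA.
- by [].
- exact: addn0.
- move=> a a' b b' c c'.
  elim/bcls_ind=> u hu; elim/bcls_ind=> v hv; elim/bcls_ind=> w hw.
  rewrite /= !btensE; apply: bcls_hom_eq; rewrite ?addnA //.
  rewrite /wtens !map_cat -!map_comp -catA.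
  by congr (_ ++ (_ ++ _)); apply: eq_map => -[] x y /=; rewrite ?addnA.
- move=> a a'; elim/bcls_ind=> u hu; rewrite /= btensE; apply: bcls_hom_eq => //.
  by rewrite /wtens /= -[RHS]map_id; apply: eq_map => -[].
- move=> a a'; elim/bcls_ind=> u hu; rewrite /= btensE.
  apply: bcls_hom_eq; rewrite ?addn0 //.
  rewrite /wtens /= cats0 -[RHS]map_id; apply: eq_map => -[] x y /=;
  by rewrite addn0.
Defined.

Reserved Notation "a ⊗ b" (at level 39, left associativity).
Reserved Notation "f ⊗ₘ g" (at level 39, left associativity).

Record monoidal := Monoidal {
  mcat : category;
  mtens : mcat -> mcat -> mcat;
  mtensm : forall a a' b b' : mcat,
    hom a a' -> hom b b' -> hom (mtens a b) (mtens a' b');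
  munit : mcat;
  massoc : forall a b c, iso (mtens (mtens a b) c) (mtens a (mtens b c));
  mlunit : forall a, iso (mtens munit a) a;
  mrunit : forall a, iso (mtens a munit) a;
  mtens_id : forall a b, mtensm (idm a) (idm b) = idm (mtens a b);
  mtens_comp : forall a a' a'' b b' b'' (f' : hom a' a'') (f : hom a a')
      (g' : hom b' b'') (g : hom b b'),
    mtensm (f' ∘ f) (g' ∘ g) = mtensm f' g' ∘ mtensm f g;
  massoc_nat : forall a a' b b' c c' (f : hom a a') (g : hom b b') (h : hom c c'),
    massoc a' b' c' ∘ mtensm (mtensm f g) h
    = mtensm f (mtensm g h) ∘ massoc a b c;
  mlunit_nat : forall a a' (f : hom a a'),
    mlunit a' ∘ mtensm (idm munit) f = f ∘ mlunit a;
  mrunit_nat : forall a a' (f : hom a a'),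
    mrunit a' ∘ mtensm f (idm munit) = f ∘ mrunit a;
  mpentagon : forall a b c d,
    mtensm (idm a) (massoc b c d) ∘ massoc a (mtens b c) d
      ∘ mtensm (massoc a b c) (idm d)
    = massoc a b (mtens c d) ∘ massoc (mtens a b) c d;
  mtriangle : forall a b,
    mtensm (idm a) (mlunit b) ∘ massoc a munit b = mtensm (mrunit a) (idm b) }.
Coercion mcat : monoidal >-> category.
Arguments mtensm {_ a a' b b'} f g.
Arguments munit {_}.
Arguments massoc {_} a b c.
Arguments mlunit {_} a.
Arguments mrunit {_} a.
Notation "a ⊗ b" := (mtens a b) : cat_scope.
Notation "f ⊗ₘ g" := (mtensm f g) : cat_scope.

Record monoidal_functor (C D : monoidal) := MonoidalFunctor {
  mfun : functor C D;
  mphi2 : forall X Y : C, iso (mfun X ⊗ mfun Y) (mfun (X ⊗ Y));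
  mphi0 : iso munit (mfun munit);
  mphi2_nat : forall (X X' Y Y' : C) (f : hom X X') (g : hom Y Y'),
    mphi2 X' Y' ∘ (fmap mfun f ⊗ₘ fmap mfun g) = fmap mfun (f ⊗ₘ g) ∘ mphi2 X Y;
  mphi2_assoc : forall X Y Z : C,
    fmap mfun (massoc X Y Z) ∘ mphi2 (X ⊗ Y) Z ∘ (mphi2 X Y ⊗ₘ idm (mfun Z))
    = mphi2 X (Y ⊗ Z) ∘ (idm (mfun X) ⊗ₘ mphi2 Y Z)
      ∘ massoc (mfun X) (mfun Y) (mfun Z);
  mphi2_lunit : forall X : C,
    fmap mfun (mlunit X) ∘ mphi2 munit X ∘ (mphi0 ⊗ₘ idm (mfun X))
    = mlunit (mfun X);
  mphi2_runit : forall X : C,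
    fmap mfun (mrunit X) ∘ mphi2 X munit ∘ (idm (mfun X) ⊗ₘ mphi0)
    = mrunit (mfun X) }.
Coercion mfun : monoidal_functor >-> functor.

Record braided_coalgebra (M : monoidal) := BraidedCoalgebra {
  bc : M;
  bcomul : hom bc (bc ⊗ bc);
  bcounit : hom bc munit;
  bbraid : iso (bc ⊗ bc) (bc ⊗ bc);
  bcoassoc :
    massoc bc bc bc ∘ (bcomul ⊗ₘ idm bc) ∘ bcomul = (idm bc ⊗ₘ bcomul) ∘ bcomul;
  bcounitl : (bcounit ⊗ₘ idm bc) ∘ bcomul = (mlunit bc)^-1;
  bcounitr : (idm bc ⊗ₘ bcounit) ∘ bcomul = (mrunit bc)^-1;
  byang_baxter :
    massoc bc bc bc ∘ (bbraid ⊗ₘ idm bc) ∘ (massoc bc bc bc)^-1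
      ∘ (idm bc ⊗ₘ bbraid) ∘ massoc bc bc bc ∘ (bbraid ⊗ₘ idm bc)
    = (idm bc ⊗ₘ bbraid) ∘ massoc bc bc bc ∘ (bbraid ⊗ₘ idm bc)
      ∘ (massoc bc bc bc)^-1 ∘ (idm bc ⊗ₘ bbraid) ∘ massoc bc bc bc;
  bcounitl_braid :
    mlunit bc ∘ (bcounit ⊗ₘ idm bc) ∘ bbraid = mrunit bc ∘ (idm bc ⊗ₘ bcounit);
  bcounitr_braid :
    mrunit bc ∘ (idm bc ⊗ₘ bcounit) ∘ bbraid = mlunit bc ∘ (bcounit ⊗ₘ idm bc);
  bcomull_braid :
    massoc bc bc bc ∘ (bcomul ⊗ₘ idm bc) ∘ bbraid
    = (idm bc ⊗ₘ bbraid) ∘ massoc bc bc bc ∘ (bbraid ⊗ₘ idm bc)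
      ∘ (massoc bc bc bc)^-1 ∘ (idm bc ⊗ₘ bcomul);
  bcomulr_braid :
    (massoc bc bc bc)^-1 ∘ (idm bc ⊗ₘ bcomul) ∘ bbraid
    = (bbraid ⊗ₘ idm bc) ∘ (massoc bc bc bc)^-1 ∘ (idm bc ⊗ₘ bbraid)
      ∘ massoc bc bc bc ∘ (bcomul ⊗ₘ idm bc) }.
Coercion bc : braided_coalgebra >-> ob.
Arguments bcomul {M} _.
Arguments bcounit {M} _.
Arguments bbraid {M} _.

Section Cancellation.
Variable C : category.

Lemma iso_monoE (a b x : C) (i : iso a b) (f g : hom x a) :
  i ∘ f = i ∘ g -> f = g.
Proof.
by move=> e; rewrite -(compIl f) -(compIl g) -(iso_invK i) -!compA e.
Qed.

Lemma iso_epiE (a b x : C) (i : iso a b) (f g : hom b x) :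
  f ∘ i = g ∘ i -> f = g.
Proof.
by move=> e; rewrite -(compIr f) -(compIr g) -(iso_homK i) !compA e.
Qed.

Lemma comp_invK (a b x : C) (i : iso a b) (f : hom a x) : f ∘ i^-1 ∘ i = f.
Proof. by rewrite -compA iso_invK compIr. Qed.

Lemma comp_homK (a b x : C) (i : iso a b) (f : hom b x) : f ∘ i ∘ i^-1 = f.
Proof. by rewrite -compA iso_homK compIr. Qed.

End Cancellation.

Section MonoidalFacts.
Variable M : monoidal.
Implicit Types a b c d : M.

Lemma mtens_compl a b b' b'' (g : hom b' b'') (f : hom b b') :
  idm a ⊗ₘ (g ∘ f) = (idm a ⊗ₘ g) ∘ (idm a ⊗ₘ f).
Proof. by rewrite -mtens_comp compIl. Qed.

Lemma mtens_compr a b b' b'' (g : hom b' b'') (f : hom b b') :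
  (g ∘ f) ⊗ₘ idm a = (g ⊗ₘ idm a) ∘ (f ⊗ₘ idm a).
Proof. by rewrite -mtens_comp compIl. Qed.

Lemma mtens_swap a a' b b' (f : hom a a') (g : hom b b') :
  (f ⊗ₘ idm b') ∘ (idm a ⊗ₘ g) = (idm a' ⊗ₘ g) ∘ (f ⊗ₘ idm b).
Proof. by rewrite -!mtens_comp !compIl !compIr. Qed.

Lemma munitl_inj a b (f g : hom a b) :
  idm munit ⊗ₘ f = idm munit ⊗ₘ g -> f = g.
Proof.
by move=> e; apply: (iso_epiE (i := mlunit a)); rewrite -!mlunit_nat e.
Qed.

Definition iso_tensr a b c (i : iso a b) : iso (a ⊗ c) (b ⊗ c).
Proof.
exists (i ⊗ₘ idm c) (i^-1 ⊗ₘ idm c).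
- by rewrite -mtens_compr iso_invK mtens_id.
- by rewrite -mtens_compr iso_homK mtens_id.
Defined.

(* Kelly's coherence: l_{a ⊗ b} ∘ a_{I,a,b} = l_a ⊗ b. *)
Lemma mlunit_tens a b :
  mlunit (a ⊗ b) ∘ massoc munit a b = mlunit a ⊗ₘ idm b.
Proof.
apply: munitl_inj.
apply: (iso_epiE (i := massoc munit (munit ⊗ a) b)).
apply: (iso_epiE (i := iso_tensr b (massoc munit munit a))).
rewrite mtens_compl /= -!compA (compA (idm _ ⊗ₘ massoc _ _ _)) mpentagon.
rewrite compA mtriangle -mtens_id -massoc_nat compA -massoc_nat.
by rewrite -compA -mtens_compr mtriangle.
Qed.

End MonoidalFacts.

Section Intertwining.
Variable C : category.

Lemma comp_sq2 (a b a' b' : C) (w : hom a b) (w' : hom a' b')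
    (S : hom b b') (s : hom a a') (T : hom b b) (t : hom a a) :
  S ∘ w = w' ∘ s -> T ∘ w = w ∘ t -> S ∘ T ∘ w = w' ∘ (s ∘ t).
Proof. by move=> e1 e2; rewrite -compA e2 compA e1 compA. Qed.

Lemma comp_sq3 (a b a' b' : C) (w : hom a b) (w' : hom a' b')
    (S : hom b b') (s : hom a a') (T U : hom b' b') (t u : hom a' a') :
  S ∘ w = w' ∘ s -> T ∘ w' = w' ∘ t -> U ∘ w' = w' ∘ u ->
  T ∘ U ∘ S ∘ w = w' ∘ (t ∘ u ∘ s).
Proof.
by move=> e1 e2 e3; rewrite -compA e1 -(compA T) (compA U) e3 !compA e2.
Qed.

End Intertwining.

Section Ttilde.
Variables (M : monoidal) (B : braided_coalgebra M).
Notation C := (bc B).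
Implicit Types X Y : M.

Fact tensl_id X : idm C ⊗ₘ idm X = idm (C ⊗ X).
Proof. exact: mtens_id. Qed.

Definition tensl : functor M M :=
  @Functor M M (fun X => C ⊗ X) (fun X Y f => idm C ⊗ₘ f)
    tensl_id (fun X Y Z g f => mtens_compl C g f).

Definition d0 X : hom (C ⊗ X) X := mlunit X ∘ (bcounit B ⊗ₘ idm X).
Definition s0 X : hom (C ⊗ X) (C ⊗ (C ⊗ X)) :=
  massoc C C X ∘ (bcomul B ⊗ₘ idm X).
Definition t0 (x : hom (C ⊗ C) (C ⊗ C)) X : hom (C ⊗ (C ⊗ X)) (C ⊗ (C ⊗ X)) :=
  massoc C C X ∘ (x ⊗ₘ idm X) ∘ (massoc C C X)^-1.

Lemma d0_nat X Y (f : hom X Y) : d0 Y ∘ (idm C ⊗ₘ f) = f ∘ d0 X.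
Proof. by rewrite /d0 -compA mtens_swap compA mlunit_nat compA. Qed.

Lemma s0_nat X Y (f : hom X Y) :
  s0 Y ∘ (idm C ⊗ₘ f) = (idm C ⊗ₘ (idm C ⊗ₘ f)) ∘ s0 X.
Proof. by rewrite /s0 -compA mtens_swap compA -mtens_id massoc_nat compA. Qed.

Lemma t0_nat x X Y (f : hom X Y) :
  t0 x Y ∘ (idm C ⊗ₘ (idm C ⊗ₘ f)) = (idm C ⊗ₘ (idm C ⊗ₘ f)) ∘ t0 x X.
Proof.
apply: (iso_epiE (i := massoc C C X)); rewrite /t0 !compA comp_invK -massoc_nat.
rewrite -(compA _ _ (massoc C C X)) -massoc_nat !compA comp_invK -!compA.
by rewrite mtens_id mtens_swap.
Qed.

Definition t3_def X :
  iso (((C ⊗ C) ⊗ C) ⊗ X) (C ⊗ (C ⊗ (C ⊗ X))).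
Proof.
exists (massoc C C (C ⊗ X) ∘ massoc (C ⊗ C) C X)
  ((massoc (C ⊗ C) C X)^-1 ∘ (massoc C C (C ⊗ X))^-1).
- by rewrite compA comp_invK iso_invK.
- by rewrite compA comp_homK iso_homK.
Defined.

Definition t3 X := locked (t3_def X).

Lemma t3D X : t3 X = massoc C C (C ⊗ X) ∘ massoc (C ⊗ C) C X :> hom _ _.
Proof. by rewrite /t3 -lock. Qed.

Lemma t3E X : t3 X = (idm C ⊗ₘ massoc C C X) ∘ massoc C (C ⊗ C) X
      ∘ (massoc C C C ⊗ₘ idm X) :> hom _ _.
Proof. by rewrite t3D mpentagon. Qed.

Lemma t0_assoc x X : t0 x X ∘ massoc C C X = massoc C C X ∘ (x ⊗ₘ idm X).
Proof. by rewrite /t0 comp_invK. Qed.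

Lemma t0_t3l x X : t0 x (C ⊗ X) ∘ t3 X = t3 X ∘ ((x ⊗ₘ idm C) ⊗ₘ idm X).
Proof.
by rewrite t3D compA t0_assoc -compA -mtens_id -massoc_nat compA.
Qed.

Lemma t0_t3r x X : (idm C ⊗ₘ t0 x X) ∘ t3 X
  = t3 X ∘ (((massoc C C C)^-1 ∘ (idm C ⊗ₘ x) ∘ massoc C C C) ⊗ₘ idm X).
Proof.
rewrite t3E !compA -mtens_compl t0_assoc mtens_compl -!compA.
rewrite -mtens_compr !compA iso_homK compIl mtens_compr !compA.
by rewrite -(compA (idm C ⊗ₘ massoc C C X) (massoc C (C ⊗ C) X)) massoc_nat !compA.
Qed.

Lemma s0_t3l X :
  s0 (C ⊗ X) ∘ massoc C C X = t3 X ∘ ((bcomul B ⊗ₘ idm C) ⊗ₘ idm X).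
Proof. by rewrite t3D /s0 -!compA massoc_nat mtens_id. Qed.

Lemma s0_t3r X : (idm C ⊗ₘ s0 X) ∘ massoc C C X
  = t3 X ∘ (((massoc C C C)^-1 ∘ (idm C ⊗ₘ bcomul B)) ⊗ₘ idm X).
Proof.
rewrite t3E /s0 mtens_compl -!compA -mtens_compr !compA iso_homK compIl.
by rewrite -!compA massoc_nat.
Qed.

Lemma d0_assocl X : d0 (C ⊗ X) ∘ massoc C C X
  = (mlunit C ∘ (bcounit B ⊗ₘ idm C)) ⊗ₘ idm X.
Proof.
by rewrite /d0 -compA -mtens_id -massoc_nat compA mlunit_tens mtens_compr.
Qed.

Lemma d0_assocr X : (idm C ⊗ₘ d0 X) ∘ massoc C C X
  = (mrunit C ∘ (idm C ⊗ₘ bcounit B)) ⊗ₘ idm X.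
Proof.
by rewrite /d0 mtens_compl -compA -massoc_nat compA mtriangle mtens_compr.
Qed.

Lemma d0_s0l X : d0 (C ⊗ X) ∘ s0 X = idm _.
Proof.
by rewrite /s0 compA d0_assocl -mtens_compr -compA bcounitl iso_homK mtens_id.
Qed.

Lemma d0_s0r X : (idm C ⊗ₘ d0 X) ∘ s0 X = idm _.
Proof.
by rewrite /s0 compA d0_assocr -mtens_compr -compA bcounitr iso_homK mtens_id.
Qed.

Lemma s0_s0 X : s0 (C ⊗ X) ∘ s0 X = (idm C ⊗ₘ s0 X) ∘ s0 X.
Proof.
rewrite {2 4}/s0 !compA s0_t3l s0_t3r -!compA -!mtens_compr; congr (_ ∘ (_ ⊗ₘ _)).
apply: (iso_monoE (i := massoc C C C)).
by rewrite compA bcoassoc !compA iso_homK compIl.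
Qed.

Lemma t0K x y X : x ∘ y = idm _ -> t0 x X ∘ t0 y X = idm _.
Proof.
move=> xy; rewrite /t0 !compA comp_invK -(compA (massoc C C X)) -mtens_compr xy.
by rewrite mtens_id compIr iso_homK.
Qed.

Notation t := (t0 (bbraid B)).

Lemma t0_yb X : t (C ⊗ X) ∘ (idm C ⊗ₘ t X) ∘ t (C ⊗ X)
  = (idm C ⊗ₘ t X) ∘ t (C ⊗ X) ∘ (idm C ⊗ₘ t X).
Proof.
apply: (iso_epiE (i := t3 X)).
have l := t0_t3l (bbraid B) X; have r := t0_t3r (bbraid B) X.
rewrite (comp_sq3 l l r) (comp_sq3 r r l) -!mtens_compr.
congr (_ ∘ (_ ⊗ₘ _)); apply: (iso_monoE (i := massoc C C C)).
by rewrite !compA byang_baxter iso_homK compIl.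
Qed.

Lemma d0_t0l X : d0 (C ⊗ X) ∘ t X = idm C ⊗ₘ d0 X.
Proof.
apply: (iso_epiE (i := massoc C C X)).
by rewrite -compA t0_assoc compA d0_assocl d0_assocr -mtens_compr bcounitl_braid.
Qed.

Lemma d0_t0r X : (idm C ⊗ₘ d0 X) ∘ t X = d0 (C ⊗ X).
Proof.
apply: (iso_epiE (i := massoc C C X)).
by rewrite -compA t0_assoc compA d0_assocl d0_assocr -mtens_compr bcounitr_braid.
Qed.

Lemma s0_t0r X : (idm C ⊗ₘ s0 X) ∘ t X
  = t (C ⊗ X) ∘ (idm C ⊗ₘ t X) ∘ s0 (C ⊗ X).
Proof.
apply: (iso_epiE (i := massoc C C X)).
rewrite (comp_sq2 (s0_t3r X) (t0_assoc _ X)).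
rewrite (comp_sq3 (s0_t3l X) (t0_t3l _ X) (t0_t3r _ X)) -!mtens_compr.
by congr (_ ∘ (_ ⊗ₘ _)); rewrite bcomulr_braid !compA.
Qed.

Lemma s0_t0l X : s0 (C ⊗ X) ∘ t X
  = (idm C ⊗ₘ t X) ∘ t (C ⊗ X) ∘ (idm C ⊗ₘ s0 X).
Proof.
apply: (iso_epiE (i := massoc C C X)).
rewrite (comp_sq2 (s0_t3l X) (t0_assoc _ X)).
rewrite (comp_sq3 (s0_t3r X) (t0_t3r _ X) (t0_t3l _ X)) -!mtens_compr.
congr (_ ∘ (_ ⊗ₘ _)); apply: (iso_monoE (i := massoc C C C)).
by rewrite !compA bcomull_braid iso_homK compIl.
Qed.

(* [Tpow n] is C ⊗ (C ⊗ ... (C ⊗ -)), with n factors. *)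
Fixpoint Tpow (n : nat) : functor M M :=
  if n is n'.+1 then tensl ⊚ Tpow n' else fid M.

(* The images of the generators: d0, s0 or t0 applied after j copies of C
   (for δ_j^n, σ_j^n and τ_{j+1}^n); out of range indices get junk values. *)
Fixpoint Tdlt (j n : nat) X : hom (Tpow n.+1 X) (Tpow n X) :=
  match j, n with
  | j'.+1, n'.+1 => idm C ⊗ₘ Tdlt j' n' X
  | _, n => d0 (Tpow n X)
  end.

Fixpoint Tsgm (j n : nat) X : hom (Tpow n.+1 X) (Tpow n.+2 X) :=
  match j, n with
  | j'.+1, n'.+1 => idm C ⊗ₘ Tsgm j' n' X
  | _, n => s0 (Tpow n X)
  end.

Fixpoint Ttau x (j n : nat) X : hom (Tpow n.+1 X) (Tpow n.+1 X) :=
  match j, n with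
  | j'.+1, n'.+1 => idm C ⊗ₘ Ttau x j' n' X
  | 0, n'.+1 => t0 x (Tpow n' X)
  | _, 0 => idm (C ⊗ X)
  end.

Definition Tgen (g : gen) X : hom (Tpow (gtgt g) X) (Tpow (gsrc g) X) :=
  match g with
  | dlt n j => Tdlt j n X
  | sgm n j => Tsgm j n X
  | tau n i => Ttau (bbraid B) i.-1 n X
  | taui n i => Ttau (bbraid B)^-1 i.-1 n X
  end.

Definition Tcast m n (e : m = n) X : hom (Tpow n X) (Tpow m X) :=
  match e with erefl => idm (Tpow m X) end.

Fact wf_nilE m n : wf m n [::] -> m = n.
Proof. exact: eqP. Qed.
Fact wf_consE m n g w : wf m n (g :: w) -> gtgt g = n.
Proof. by case/and3P=> _ /eqP. Qed.
Fact wf_tail m n g w : wf m n (g :: w) -> wf m (gsrc g) w.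
Proof. by case/and3P. Qed.

Fixpoint Tword m n w : wf m n w -> forall X, hom (Tpow n X) (Tpow m X) :=
  match w return wf m n w -> forall X, hom (Tpow n X) (Tpow m X) with
  | [::] => fun h X => Tcast (wf_nilE h) X
  | g :: w' => fun h X =>
      Tword (wf_tail h) X ∘ (Tgen g X ∘ Tcast (wf_consE h) X)
  end.

Lemma TcastE n (e : n = n) X : Tcast e X = idm (Tpow n X).
Proof. by rewrite (Prop_irrelevance e erefl). Qed.

Lemma Tword_irr m n w (h h' : wf m n w) X : Tword h X = Tword h' X.
Proof. by rewrite (Prop_irrelevance h h'). Qed.

Lemma Tword_cat m p n u v (hu : wf p n u) (hv : wf m p v)
    (h : wf m n (u ++ v)) X : Tword h X = Tword hv X ∘ Tword hu X.
Proof.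
elim: u n hu h => [|g u IH] n hu h /=.
  have e : p = n by exact/eqP.
  by subst p; rewrite TcastE compIr; exact: Tword_irr.
rewrite (IH _ (wf_tail hu)) -compA; congr (_ ∘ (_ ∘ (_ ∘ Tcast _ _))).
exact: Prop_irrelevance.
Qed.

Lemma Tcast_nat m n (e : m = n) X Y (f : hom X Y) :
  Tcast e Y ∘ fmap (Tpow n) f = fmap (Tpow m) f ∘ Tcast e X.
Proof. by subst n; rewrite !TcastE compIl compIr. Qed.

Lemma Tdlt_nat j n X Y (f : hom X Y) :
  Tdlt j n Y ∘ fmap (Tpow n.+1) f = fmap (Tpow n) f ∘ Tdlt j n X.
Proof.
elim: j n => [|j IH] [|n]; try exact: d0_nat.
by rewrite /= -!mtens_compl; congr (_ ⊗ₘ _); exact: IH.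
Qed.

Lemma Tsgm_nat j n X Y (f : hom X Y) :
  Tsgm j n Y ∘ fmap (Tpow n.+1) f = fmap (Tpow n.+2) f ∘ Tsgm j n X.
Proof.
elim: j n => [|j IH] [|n]; try exact: s0_nat.
by rewrite /= -!mtens_compl; congr (_ ⊗ₘ _); exact: IH.
Qed.

Lemma Ttau_nat x j n X Y (f : hom X Y) :
  Ttau x j n Y ∘ fmap (Tpow n.+1) f = fmap (Tpow n.+1) f ∘ Ttau x j n X.
Proof.
elim: j n => [|j IH] [|n] //=; try by rewrite compIl compIr.
  exact: t0_nat.
by rewrite /= -!mtens_compl; congr (_ ⊗ₘ _); exact: IH.
Qed.

Lemma Tgen_nat g X Y (f : hom X Y) :
  Tgen g Y ∘ fmap (Tpow (gtgt g)) f = fmap (Tpow (gsrc g)) f ∘ Tgen g X.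
Proof.
case: g => n j; [exact: Tdlt_nat|exact: Tsgm_nat|exact: Ttau_nat|exact: Ttau_nat].
Qed.

Lemma Tword_nat m n w (h : wf m n w) X Y (f : hom X Y) :
  Tword h Y ∘ fmap (Tpow n) f = fmap (Tpow m) f ∘ Tword h X.
Proof.
elim: w n h => [|g w IH] n h /=; first exact: Tcast_nat.
by rewrite -!compA Tcast_nat (compA (Tgen g Y)) Tgen_nat 2!compA IH !compA.
Qed.

Lemma T_dd i j n X : i <= j <= n ->
  Tdlt i n X ∘ Tdlt j.+1 n.+1 X = Tdlt j n X ∘ Tdlt i n.+1 X.
Proof.
elim: i j n => [|i IH] [|j] [|n] h; try (exfalso; lia); try exact: d0_nat.
by rewrite /= -!mtens_compl; congr (_ ⊗ₘ _); exact: IH.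
Qed.

Lemma T_ss i j n X : i <= j <= n ->
  Tsgm i n.+1 X ∘ Tsgm j n X = Tsgm j.+1 n.+1 X ∘ Tsgm i n X.
Proof.
elim: i j n => [|i IH] [|j] [|n] h; try (exfalso; lia); try exact: s0_s0; try exact: s0_nat.
by rewrite /= -!mtens_compl; congr (_ ⊗ₘ _); exact: IH.
Qed.

Lemma T_sd_lt i j n X : i <= j <= n ->
  Tdlt i n.+2 X ∘ Tsgm j.+1 n.+1 X = Tsgm j n X ∘ Tdlt i n.+1 X.
Proof.
elim: i j n => [|i IH] [|j] [|n] h; try (exfalso; lia); try exact: d0_nat.
by rewrite /= -!mtens_compl; congr (_ ⊗ₘ _); exact: IH.
Qed.

Lemma T_sd_eq j n X : j <= n -> Tdlt j n.+1 X ∘ Tsgm j n X = idm _.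
Proof.
elim: j n => [|j IH] [|n] h; try (exfalso; lia); try exact: d0_s0l.
by rewrite /= -!mtens_compl; rewrite [X in _ ⊗ₘ X]IH // mtens_id.
Qed.

Lemma T_sd_eqS j n X : j <= n -> Tdlt j.+1 n.+1 X ∘ Tsgm j n X = idm _.
Proof.
elim: j n => [|j IH] [|n] h; try (exfalso; lia); try exact: d0_s0r.
by rewrite [LHS]/= -!mtens_compl; rewrite [X in _ ⊗ₘ X]IH // mtens_id.
Qed.

Lemma T_sd_gt i j n X : j < i <= n.+1 ->
  Tdlt i.+1 n.+2 X ∘ Tsgm j n.+1 X = Tsgm j n X ∘ Tdlt i n.+1 X.
Proof.
elim: j i n => [|j IH] [|i] [|n] h; try (exfalso; lia); try exact/esym/s0_nat.
by rewrite [LHS]/= [RHS]/= -!mtens_compl; congr (_ ⊗ₘ _); exact: IH.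
Qed.

Lemma T_tauK x y i n X : x ∘ y = idm _ -> Ttau x i n X ∘ Ttau y i n X = idm _.
Proof.
move=> xy; elim: i n => [|i IH] [|n] /=; try exact: compIl; try exact: t0K.
by rewrite -mtens_compl IH mtens_id.
Qed.

Notation Tt := (Ttau (bbraid B)).

Lemma T_yb i n X : i.+1 < n ->
  Tt i n X ∘ Tt i.+1 n X ∘ Tt i n X = Tt i.+1 n X ∘ Tt i n X ∘ Tt i.+1 n X.
Proof.
elim: i n => [|i IH] [|[|n]] h; try (exfalso; lia); first exact: t0_yb.
by rewrite [LHS]/= [RHS]/= -!mtens_compl; congr (_ ⊗ₘ _); exact: (IH n.+1).
Qed.

Lemma T_tt i j n X : i.+1 < j < n -> Tt i n X ∘ Tt j n X = Tt j n X ∘ Tt i n X.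
Proof.
elim: i j n => [|i IH] [|[|j]] [|[|n]] h; try (exfalso; lia); try exact: t0_nat.
by rewrite [LHS]/= [RHS]/= -!mtens_compl; congr (_ ⊗ₘ _); exact: (IH j.+1 n.+1).
Qed.

Lemma T_td_lt i j n X : i < j <= n ->
  Tdlt j.+1 n.+1 X ∘ Tt i n.+1 X = Tt i n X ∘ Tdlt j.+1 n.+1 X.
Proof.
elim: i j n => [|i IH] [|j] [|n] h; try (exfalso; lia); try exact/esym/t0_nat.
by rewrite [LHS]/= [RHS]/= -!mtens_compl; congr (_ ⊗ₘ _); exact: IH.
Qed.

Lemma T_td_eq i n X : i < n -> Tdlt i.+1 n X ∘ Tt i n X = Tdlt i n X.
Proof.
elim: i n => [|i IH] [|n] h; try (exfalso; lia); first exact: d0_t0r.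
by rewrite [LHS]/= [RHS]/= -!mtens_compl; congr (_ ⊗ₘ _); exact: IH.
Qed.

Lemma T_td_eqS j n X : j < n -> Tdlt j n X ∘ Tt j n X = Tdlt j.+1 n X.
Proof.
elim: j n => [|j IH] [|n] h; try (exfalso; lia); first exact: d0_t0l.
by rewrite [LHS]/= [RHS]/= -!mtens_compl; congr (_ ⊗ₘ _); exact: IH.
Qed.

Lemma T_td_gt i j n X : j <= i < n ->
  Tdlt j n.+1 X ∘ Tt i.+1 n.+1 X = Tt i n X ∘ Tdlt j n.+1 X.
Proof.
elim: j i n => [|j IH] [|i] [|n] h; try (exfalso; lia); try exact: d0_nat.
by rewrite [LHS]/= [RHS]/= -!mtens_compl; congr (_ ⊗ₘ _); exact: IH.
Qed.

Lemma T_ts_lt i j n X : i.+1 < j <= n ->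
  Tsgm j n X ∘ Tt i n X = Tt i n.+1 X ∘ Tsgm j n X.
Proof.
elim: i j n => [|i IH] [|[|j]] [|[|n]] h; try (exfalso; lia); try exact/esym/t0_nat.
by rewrite [LHS]/= [RHS]/= -!mtens_compl; congr (_ ⊗ₘ _); exact: (IH j.+1 n.+1).
Qed.

Lemma T_ts_eq i n X : i < n ->
  Tsgm i.+1 n X ∘ Tt i n X = Tt i n.+1 X ∘ Tt i.+1 n.+1 X ∘ Tsgm i n X.
Proof.
elim: i n => [|i IH] [|n] h; try (exfalso; lia); first exact: s0_t0r.
by rewrite [LHS]/= [RHS]/= -!mtens_compl; congr (_ ⊗ₘ _); exact: IH.
Qed.

Lemma T_ts_eqS j n X : j < n ->
  Tsgm j n X ∘ Tt j n X = Tt j.+1 n.+1 X ∘ Tt j n.+1 X ∘ Tsgm j.+1 n X.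
Proof.
elim: j n => [|j IH] [|n] h; try (exfalso; lia); first exact: s0_t0l.
by rewrite [LHS]/= [RHS]/= -!mtens_compl; congr (_ ⊗ₘ _); exact: IH.
Qed.

Lemma T_ts_gt i j n X : j < i < n ->
  Tsgm j n X ∘ Tt i n X = Tt i.+1 n.+1 X ∘ Tsgm j n X.
Proof.
elim: j i n => [|j IH] [|i] [|n] h; try (exfalso; lia); try exact: s0_nat.
by rewrite [LHS]/= [RHS]/= -!mtens_compl; congr (_ ⊗ₘ _); exact: IH.
Qed.

Lemma wf_ends m n g w : wf m n (g :: w) -> n = gtgt g /\ m = gsrc (last g w).
Proof.
elim: w g n => [|g' w IH] g n /= /and3P[_ /eqP<-]; first by move/eqP.
by case/IH=> _ ->.
Qed.

Lemma wf_src_inj p p' n w : wf p n w -> wf p' n w -> p = p'.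
Proof.
elim: w n => [n /eqP-> /eqP-> //|g w IH n /= /and3P[_ _ h] /and3P[_ _ h']].
exact: IH h h'.
Qed.

Lemma wf_tgt_inj m p p' w : wf m p w -> wf m p' w -> p = p'.
Proof.
case: w => [/eqP<- /eqP<- //|g w /and3P[_ /eqP<- _] /and3P[_ /eqP<- _]] //.
Qed.

Ltac Tword_simpl hl :=
  case: (wf_ends hl) => /= ? ?; subst;
  rewrite /= !TcastE !(compIl, compIr).

Lemma Tword_brel m n l r (hl : wf m n l) (hr : wf m n r) X :
  brel l r -> Tword hl X = Tword hr X.
Proof.
move=> lr; case: lr hl hr.
- case=> [|k] i [|j] h hl hr; try (exfalso; lia).
  Tword_simpl hl; exact: T_dd.
- move=> k i j h hl hr; Tword_simpl hl; exact: T_ss.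
- case=> [|k] i [|j] h hl hr; try (exfalso; lia).
  Tword_simpl hl; exact: T_sd_lt.
- move=> k i j h e hl hr; Tword_simpl hl.
  by case/orP: e => /eqP->; [exact: T_sd_eq | exact: T_sd_eqS].
- case=> [|k] [|i] j h hl hr; try (exfalso; lia).
  Tword_simpl hl; apply: T_sd_gt; lia.
- move=> k i h hl hr; Tword_simpl hl; apply: T_tauK; exact: iso_homK.
- move=> k i h hl hr; Tword_simpl hl; apply: T_tauK; exact: iso_invK.
- move=> k [|i] h hl hr; first by exfalso; lia.
  Tword_simpl hl; rewrite ?compA; exact: T_yb.
- move=> k [|i] [|j] h h' h'' hl hr; try (exfalso; lia).
  Tword_simpl hl; case/orP: h'' => ij; [apply/esym|]; apply: T_tt; lia.
- case=> [|k] [|i] [|j] h h' hl hr; try (exfalso; lia).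
  Tword_simpl hl; exact: T_td_lt.
- move=> k [|i] h hl hr; try (exfalso; lia).
  Tword_simpl hl; exact: T_td_eq.
- move=> k j h hl hr; Tword_simpl hl; exact: T_td_eqS.
- case=> [|k] [|[|i]] j h hl hr; try (exfalso; lia).
  Tword_simpl hl; exact: T_td_gt.
- move=> k [|i] j h h' hl hr; try (exfalso; lia).
  Tword_simpl hl; exact: T_ts_lt.
- move=> k [|i] h hl hr; try (exfalso; lia).
  Tword_simpl hl; exact: T_ts_eq.
- move=> k j h hl hr; Tword_simpl hl; exact: T_ts_eqS.
- move=> k [|i] j h hl hr; try (exfalso; lia).
  Tword_simpl hl; exact: T_ts_gt.
Qed.

Lemma Tword_beq m n w w' (h : wf m n w) (h' : wf m n w') X :
  beq m n w w' -> Tword h X = Tword h' X.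
Proof.
move=> e; elim: e h h' => [u v l r lr _ _|x _|x y _ IH|x y z xy IH yz IH'] h h'.
- have [p hu hlv] := wf_catP h; have [q hl hv] := wf_catP hlv.
  have [p' hu' hrv] := wf_catP h'; have [q' hr hv'] := wf_catP hrv.
  have ? : p = p' by exact: wf_src_inj hu hu'.
  have ? : q = q' by exact: wf_tgt_inj hv hv'.
  subst p' q'; rewrite (Tword_cat hu hlv) (Tword_cat hu hrv); congr (_ ∘ _).
  rewrite (Tword_cat hl hv) (Tword_cat hr hv); congr (_ ∘ _).
  exact: Tword_brel.
- exact: Tword_irr.
- by rewrite IH.
- by have [_ hy] := beq_wf xy; rewrite (IH h hy) (IH' hy h').
Qed.

Definition Tmor m n (f : bhom m n) : Tpow n ⟹ Tpow m :=
  NatTrans (@Tword_nat m n _ (brepr_wf f)).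

Lemma TmorE m n w (h : wf m n w) X : Tmor (bcls h) X = Tword h X.
Proof. by apply: Tword_beq; exact: bclsK. Qed.

Definition Tfunctor : functor (sopp DeltaB) (endo M).
Proof.
refine (@Functor (sopp DeltaB) (endo M) Tpow (fun a b => @Tmor b a) _ _).
- by move=> a; apply: nat_trans_eq => X; rewrite TmorE /= TcastE.
- move=> a b c; elim/bcls_ind=> v hv; elim/bcls_ind=> u hu.
  apply: nat_trans_eq => X.
  change (Tmor (bcomp (bcls hu) (bcls hv)) X
    = Tmor (bcls hv) X ∘ Tmor (bcls hu) X).
  by rewrite bcompE !TmorE (Tword_cat hu hv).
Defined.

Lemma Tpow_add m n : Tpow (m + n) = Tpow m ⊚ Tpow n.
Proof.
elim: m => [|m IH] /=; first exact: functor_eq.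
by rewrite IH; exact: functor_eq.
Qed.

Lemma Tpow_addE m n X : Tpow (m + n) X = Tpow m (Tpow n X).
Proof. by rewrite Tpow_add. Qed.

Lemma hom_eq_family (f g : M -> M) (s : forall X, hom (f X) (g X)) X Y :
  X = Y -> s X ≡ s Y.
Proof. by move->. Qed.

Lemma hom_eq_tensl X Y X' Y' (f : hom X Y) (f' : hom X' Y') :
  f ≡ f' -> (idm C ⊗ₘ f) ≡ (idm C ⊗ₘ f').
Proof. by case. Qed.

Lemma Tgen_shr k g X : gvalid g -> Tgen (shr k g) X ≡ Tgen g (Tpow k X).
Proof.
case: g => n j /=.
- elim: j n => [|j IH] [|n] // jn.
  + exact: (hom_eq_family d0 (Tpow_addE n.+1 k X)).
  + by apply: hom_eq_tensl; exact: IH.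
- elim: j n => [|j IH] [|n] // jn.
  + exact: (hom_eq_family s0 (Tpow_addE n.+1 k X)).
  + by apply: hom_eq_tensl; exact: IH.
- case: j => // j; elim: j n => [|j IH] [|n] // jn.
  + exact: (hom_eq_family (t0 _) (Tpow_addE n k X)).
  + by apply: hom_eq_tensl; exact: IH.
- case: j => // j; elim: j n => [|j IH] [|n] // jn.
  + exact: (hom_eq_family (t0 _) (Tpow_addE n k X)).
  + by apply: hom_eq_tensl; exact: IH.
Qed.

Lemma Tgen_shl k g X : gvalid g -> Tgen (shl k g) X ≡ fmap (Tpow k) (Tgen g X).
Proof.
move=> vg; elim: k => [|k IH]; first by case: g vg.
have -> : fmap (Tpow k.+1) (Tgen g X) = idm C ⊗ₘ fmap (Tpow k) (Tgen g X) by [].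
case: g vg IH => n [|j] //= vg IH; apply: hom_eq_trans (hom_eq_tensl IH) => //.
- by rewrite addnS.
- by rewrite addnS.
Qed.

Lemma Tcast_hom_eq m n (e : m = n) X : Tcast e X ≡ idm (Tpow m X).
Proof. by subst n; rewrite TcastE. Qed.

Lemma hom_eq_idl (a b c d e : M) (f : hom b c) (i : hom a b) (g : hom d e) :
  i ≡ idm b -> f ≡ g -> f ∘ i ≡ g.
Proof.
move=> hi; have [? _] := hom_eq_ob hi; subst b.
by rewrite (hom_eqE hi) compIr.
Qed.

Lemma Tcast_hom_eq' m n (e : m = n) X : Tcast e X ≡ idm (Tpow n X).
Proof. by subst n; rewrite TcastE. Qed.

Lemma Tword_shr k m n w (h : wf m n w) (h' : wf (m + k) (n + k) (map (shr k) w))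
  X : Tword h' X ≡ Tword h (Tpow k X).
Proof.
elim: w n h h' => [|g w IH] n h h' /=.
  apply: hom_eq_trans (hom_eq_sym (Tcast_hom_eq _ _)).
  apply: hom_eq_trans (Tcast_hom_eq _ _) _.
  by rewrite Tpow_addE.
have e : gtgt g = n := wf_consE h; subst n; rewrite TcastE compIr.
have vg : gvalid g by case/and3P: h.
have hg : Tgen (shr k g) X ≡ Tgen g (Tpow k X) by exact: Tgen_shr.
have hs : gsrc (shr k g) = gsrc g + k by case: (g).
move: (wf_tail h') (wf_consE h'); move: (Tgen (shr k g) X) hg; rewrite hs.
have ht : gtgt (shr k g) = gtgt g + k by case: (g).
rewrite ht => u hu hw e; apply: hom_eq_comp; first exact: IH.
by apply: hom_eq_idl => //; exact: Tcast_hom_eq'.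
Qed.

Lemma hom_eq_fmap (E F : category) (G : functor E F) (a b c d : E)
  (f : hom a b) (g : hom c d) : f ≡ g -> fmap G f ≡ fmap G g.
Proof. by case. Qed.

Lemma Tword_shl k m n w (h : wf m n w) (h' : wf (k + m) (k + n) (map (shl k) w))
  X : Tword h' X ≡ fmap (Tpow k) (Tword h X).
Proof.
elim: w n h h' => [|g w IH] n h h' /=.
  have e : m = n by exact/eqP.
  by subst n; rewrite !TcastE fmapI Tpow_addE.
have e : gtgt g = n := wf_consE h; subst n; rewrite TcastE compIr fmapM.
have vg : gvalid g by case/and3P: h.
have hg : Tgen (shl k g) X ≡ fmap (Tpow k) (Tgen g X) by exact: Tgen_shl.
have hs : gsrc (shl k g) = k + gsrc g by case: (g) => * /=; rewrite ?addnS.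
move: (wf_tail h') (wf_consE h'); move: (Tgen (shl k g) X) hg; rewrite hs.
have ht : gtgt (shl k g) = k + gtgt g by case: (g) => * /=; rewrite ?addnS.
rewrite ht => u hu hw e; apply: hom_eq_comp; first exact: IH.
by apply: hom_eq_idl => //; exact: Tcast_hom_eq'.
Qed.

Lemma Tmor_tens m m' n n' (f : bhom m m') (g : bhom n n') :
  @hom_eq (endo M) _ _ (Tmor (btens f g)) _ _ (Tmor f ⋆ Tmor g).
Proof.
apply: nat_trans_hom_eq; [exact: Tpow_add | exact: Tpow_add |].
elim/bcls_ind: f => u hu; elim/bcls_ind: g => v hv X.
have -> : (Tmor (bcls hu) ⋆ Tmor (bcls hv)) X
  = Tmor (bcls hu) (Tpow n X) ∘ fmap (Tpow m') (Tmor (bcls hv) X) by [].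
rewrite btensE !TmorE Tword_nat (Tword_cat (wf_shr n' hu) (wf_shl m hv)).
by apply: hom_eq_comp; [exact: Tword_shl | exact: Tword_shr].
Qed.

Definition Ttilde : strict_monoidal_functor (sopp DeltaB) (endo M) :=
  @StrictMonoidalFunctor (sopp DeltaB) (endo M) Tfunctor Tpow_add erefl
    (fun a a' b b' f g => @Tmor_tens a' a b' b f g).

(* [Ttilde] takes the following values on ⟨1⟩, δ_0^0, σ_0^0, τ_1^1, and is the
   only strict monoidal functor with these values. *)
Definition d0_trans : tensl ⟹ fid M := @NatTrans M M tensl (fid M) d0 d0_nat.
Definition s0_trans : tensl ⟹ tensl ⊚ tensl :=
  @NatTrans M M tensl (tensl ⊚ tensl) s0 s0_nat.
Definition t0_trans : tensl ⊚ tensl ⟹ tensl ⊚ tensl :=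
  @NatTrans M M (tensl ⊚ tensl) (tensl ⊚ tensl) t (t0_nat (bbraid B)).

Definition bgen g (h : gvalid g) : bhom (gsrc g) (gtgt g) := bcls (wf_gen h).

Record prescribed (X : strict_monoidal_functor (sopp DeltaB) (endo M)) : Prop := {
  presc_ob : X 1 = tensl;
  presc_dlt : @hom_eq (endo M) _ _
    (@fmap _ _ X 1 0 (@bgen (dlt 0 0) isT)) _ _ d0_trans;
  presc_sgm : @hom_eq (endo M) _ _
    (@fmap _ _ X 1 2 (@bgen (sgm 0 0) isT)) _ _ s0_trans;
  presc_tau : @hom_eq (endo M) _ _
    (@fmap _ _ X 2 2 (@bgen (tau 1 1) isT)) _ _ t0_trans }.

Lemma Tpow1 : Tpow 1 = tensl.
Proof. exact: functor_eq. Qed.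

Lemma Tpow2 : Tpow 2 = tensl ⊚ tensl.
Proof. exact: functor_eq. Qed.

Lemma Tmor_gen g (h : gvalid g) X : Tmor (bgen h) X = Tgen g X.
Proof. by rewrite TmorE /= !TcastE compIl compIr. Qed.

Lemma Ttilde_prescribed : prescribed Ttilde.
Proof.
split; first exact: Tpow1.
- apply: nat_trans_hom_eq => [|//|X]; first exact: Tpow1.
  exact/eq_hom_eq/(@Tmor_gen (dlt 0 0)).
- apply: nat_trans_hom_eq => [||X]; [exact: Tpow1 | exact: Tpow2 |].
  exact/eq_hom_eq/(@Tmor_gen (sgm 0 0)).
- apply: nat_trans_hom_eq => [||X]; [exact: Tpow2 | exact: Tpow2 |].
  exact/eq_hom_eq/(@Tmor_gen (tau 1 1)).
Qed.

Lemma hom_eq_smtensm (N : strict_monoidal) (a a' b b' c c' d d' : N)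
    (f : hom a a') (g : hom b b') (f' : hom c c') (g' : hom d d') :
  f ≡ f' -> g ≡ g' -> smtensm f g ≡ smtensm f' g'.
Proof. by case; case. Qed.

Lemma hom_eq_inv (E : category) (a b c d : E) (f : hom a b) (g : hom b a)
    (f' : hom c d) (g' : hom d c) :
  f ∘ g = idm b -> g' ∘ f' = idm c -> f ≡ f' -> g ≡ g'.
Proof.
move=> fg gf e; have [? ?] := hom_eq_ob e; subst.
move/hom_eqE: e => e; subst f'; apply: eq_hom_eq.
by rewrite -(compIl g) -gf -compA fg compIr.
Qed.

Lemma bgen_decomp k g p (vg : gvalid g) (v' : gvalid (shl k (shr p g))) :
  @hom_eq DeltaB _ _ (bgen v') _ _ (btens (bid k) (btens (bgen vg) (bid p))).
Proof.
by case: g vg v' => n j vg v'; rewrite (btensE (wf_gen vg) (wf_nil p));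
  rewrite btensE; apply: bcls_hom_eq;
  rewrite /= ?addnS.
Qed.

Lemma prescribed_unique (X Y : strict_monoidal_functor (sopp DeltaB) (endo M)) :
  prescribed X -> prescribed Y -> X = Y :> functor _ _.
Proof.
move=> pX pY.
have obE n : X n = Y n.
  elim: n => [|n IH]; first by rewrite (smfun_unit X) (smfun_unit Y).
  have := smfun_tens X 1 n; have := smfun_tens Y 1 n.
  by rewrite (presc_ob pX) (presc_ob pY) IH => <- <-.
pose agree a b (f : bhom a b) := @hom_eq (endo M) _ _ (@fmap _ _ X b a f)
  _ _ (@fmap _ _ Y b a f).
have id_ok n : agree n n (bid n).
  rewrite /agree (fmapI X n) (fmapI Y n); by rewrite obE.
have shift k p g0 (v0 : gvalid g0) (v : gvalid (shl k (shr p g0))) :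
    agree _ _ (bgen v0) -> agree _ _ (bgen v).
  move=> a0; have e := opp_hom_eq (bgen_decomp v0 v).
  apply: hom_eq_trans (hom_eq_fmap X e) _.
  apply: hom_eq_trans (hom_eq_sym (hom_eq_fmap Y e)).
  apply: hom_eq_trans (smfun_tensm X _ _) _.
  apply: hom_eq_trans (hom_eq_sym (smfun_tensm Y _ _)).
  apply: hom_eq_smtensm; first exact: id_ok.
  apply: hom_eq_trans (smfun_tensm X _ _) _.
  apply: hom_eq_trans (hom_eq_sym (smfun_tensm Y _ _)).
  by apply: hom_eq_smtensm => //; exact: id_ok.
have dlt_ok : agree _ _ (@bgen (dlt 0 0) isT).
  exact: hom_eq_trans (presc_dlt pX) (hom_eq_sym (presc_dlt pY)).
have sgm_ok : agree _ _ (@bgen (sgm 0 0) isT).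
  exact: hom_eq_trans (presc_sgm pX) (hom_eq_sym (presc_sgm pY)).
have tau_ok : agree _ _ (@bgen (tau 1 1) isT).
  exact: hom_eq_trans (presc_tau pX) (hom_eq_sym (presc_tau pY)).
have taui_ok : agree _ _ (@bgen (taui 1 1) isT).
  have K1 : bcomp (@bgen (taui 1 1) isT) (@bgen (tau 1 1) isT) = bid 2.
    by rewrite bcompE; apply/bcls_eq; exact: (@beq_tauK 1 1).
  have K2 : bcomp (@bgen (tau 1 1) isT) (@bgen (taui 1 1) isT) = bid 2.
    by rewrite bcompE; apply/bcls_eq; exact: (@beq_tauiK 1 1).
  apply: hom_eq_inv tau_ok.
  - by rewrite -(fmapM X) -(fmapI X 2); congr (fmap X).
  - by rewrite -(fmapM Y) -(fmapI Y 2); congr (fmap Y).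
have gen_ok g (v : gvalid g) : agree _ _ (bgen v).
  have [k [p [g0 [eg v0 a0]]]] : exists k p g0, [/\ g = shl k (shr p g0),
      gvalid g0 & forall v0 : gvalid g0, agree _ _ (bgen v0)].
    case: g v => n j /= v.
    - exists j, (n - j), (dlt 0 0); split=> // [|v0]; first by congr dlt; lia.
      by rewrite (Prop_irrelevance v0 isT).
    - exists j, (n - j), (sgm 0 0); split=> // [|v0]; first by congr sgm; lia.
      by rewrite (Prop_irrelevance v0 isT).
    - exists j.-1, (n - j), (tau 1 1); split=> // [|v0]; first by congr tau; lia.
      by rewrite (Prop_irrelevance v0 isT).
    - exists j.-1, (n - j), (taui 1 1); split=> // [|v0]; first by congr taui; lia.
      by rewrite (Prop_irrelevance v0 isT).
  by subst g; exact: (shift _ _ _ v0).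
apply: functor_eq => // b a; move: b a => a b.
suff P : forall (b a : nat) (f : bhom b a), agree b a f by exact: P.
move=> {}b {}a; elim/bcls_ind=> w; elim: w a => [|g w IH] a h.
  have ? := wf_nilE h; subst b; have := id_ok a.
  by rewrite /agree /bid (bcls_congr (wf_nil a) h erefl).
have ? := wf_consE h; subst a.
have vg : gvalid g by case/and3P: h.
have -> : bcls h = bcomp (bgen vg) (bcls (wf_tail h)).
  by rewrite bcompE; exact: bcls_congr.
rewrite /agree; have := @fmapM _ _ X _ _ _ (bcls (wf_tail h)) (bgen vg) => /= ->.
have := @fmapM _ _ Y _ _ _ (bcls (wf_tail h)) (bgen vg) => /= ->.
by apply: hom_eq_comp; [exact: IH | exact: gen_ok].
Qed.

Lemma Ttilde_unique (X : strict_monoidal_functor (sopp DeltaB) (endo M)) :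
  prescribed X -> X = Ttilde :> functor _ _.
Proof. by move=> pX; apply: prescribed_unique pX Ttilde_prescribed. Qed.

End Ttilde.

Notation braided_functor C := (strict_monoidal_functor (sopp DeltaB) (endo C)).

Definition stage (C : category) (X : braided_functor C) (n : nat) :
  functor C C := X n.

Definition stage_map (C : category) (X : braided_functor C) (m n : nat)
  (f : @hom DeltaB m n) : stage X n ⟹ stage X m := @fmap _ _ X n m f.

(* Equations between natural transformations, written out at each object A. *)
Record relative_morphism (C D : category)
    (X : braided_functor C) (Y : braided_functor D) (F : functor C D)
    (eta : forall n : nat, stage Y n ⊚ F ⟹ F ⊚ stage X n) : Prop :=
  RelativeMorphism {
  relm_nat : forall (m n : nat) (f : @hom DeltaB m n) (A : C),
    eta m A ∘ stage_map Y f (F A) = fmap F (stage_map X f A) ∘ eta n A;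
  relm_unit : forall A : C, eta 0 A ≡ idm (F A);
  relm_add : forall (m n : nat) (A : C),
    eta (m + n) A ≡ eta m (stage X n A) ∘ fmap (stage Y m) (eta n A) }.

(* Main.v *)
Require Import Defs.
From mathcomp Require Import all_boot.
From mathcomp Require Import boolp classical_sets functions.
(* The names of the composition lemmas of functions hide those of categories. *)
Import Defs.

(** A morphism beta : X -> F Y of D slides past F: it induces
    [lift beta A] : X ⊗ F A -> F (Y ⊗ A), natural in A.  The hypothesis on
    eta_1 says that eta_1 = [lift alpha'], and everything rests on the calculus
    of these lifts.

    The assignment of the theorem recovers alpha' from [lift alpha'] evaluated
    at I ([lift_recover]), because F I is isomorphic to I; in particular lifting
    is injective.  As eta_0 = id and
    eta_{n+1} = (eta_1 ⋆ X_n) ∘ (Y_1 ⋆ eta_n), the whole family is determined by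
    alpha' ([relative_morphism_eq]), and the assignment is injective.

    Lifts are compatible with composition on both sides, with the left unitors
    ([mphi2_lunit] is the statement for phi_0) and with the associators
    ([lift_assoc]: two successive lifts form the lift of phi_2 ∘ (beta ⊗ gamma)).
    Hence naturality of eta along delta_0^0, sigma_0^0 and tau_1^1 is, up to
    cancelling isomorphisms, the lift of the compatibility of alpha' with the
    counit, the comultiplication and the braiding respectively ([counit_lift],
    [comul_lift], [braid_lift]).  Evaluating at I gives the equalities on alpha'.
    Conversely, for alpha satisfying them, the family defined by the recursion
    above is natural along these three generators and along the inverse of
    tau_1^1, hence along their whiskerings, which are all the generators, hence
    along all words. *)

Set Implicit Arguments.
Unset Strict Implicit.
Unset Printing Implicit Defensive.

Local Open Scope classical_set_scope.
Local Open Scope cat_scope.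

(** * Lifting a morphism into the image of a monoidal functor *)

Definition iso_fmap (C D : category) (F : functor C D) (a b : C) (i : iso a b) :
  iso (F a) (F b).
Proof.
exists (fmap F i) (fmap F i^-1).
- by rewrite -fmapM iso_invK fmapI.
- by rewrite -fmapM iso_homK fmapI.
Defined.

Lemma iso_intertwine_inv (E : category) (a b : E) (i : iso a a) (j : iso b b)
    (h : hom a b) :
  h ∘ i = j ∘ h -> h ∘ i^-1 = j^-1 ∘ h.
Proof.
move=> e; apply: (iso_epiE (i := i)); rewrite comp_invK -compA e.
by rewrite compA iso_invK compIl.
Qed.

Section Lift.
Variables (C D : monoidal) (F : monoidal_functor C D).
Implicit Types (A Y Z : C) (X : D).

Definition lift X Y (b : hom X (F Y)) A : hom (X ⊗ F A) (F (Y ⊗ A)) :=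
  mphi2 F Y A ∘ (b ⊗ₘ idm (F A)).

Lemma lift_nat X Y (b : hom X (F Y)) A A' (f : hom A A') :
  lift b A' ∘ (idm X ⊗ₘ fmap F f) = fmap F (idm Y ⊗ₘ f) ∘ lift b A.
Proof.
by rewrite /lift -compA mtens_swap compA compA -mphi2_nat fmapI.
Qed.

Lemma lift_precomp X X' Y (b : hom X (F Y)) (h : hom X' X) A :
  lift (b ∘ h) A = lift b A ∘ (h ⊗ₘ idm (F A)).
Proof. by rewrite /lift mtens_compr compA. Qed.

Lemma lift_postcomp X Y Y' (b : hom X (F Y)) (g : hom Y Y') A :
  lift (fmap F g ∘ b) A = fmap F (g ⊗ₘ idm A) ∘ lift b A.
Proof. by rewrite /lift mtens_compr !compA -mphi2_nat fmapI. Qed.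

(** The associativity axiom of phi_2, in terms of lifts. *)
Lemma lift_assoc X Y X' Y' (b : hom X (F Y)) (g : hom X' (F Y')) A :
  lift b (Y' ⊗ A) ∘ (idm X ⊗ₘ lift g A) ∘ massoc X X' (F A)
  = fmap F (massoc Y Y' A) ∘ lift (mphi2 F Y Y' ∘ (b ⊗ₘ g)) A.
Proof.
have -> : lift b (Y' ⊗ A) ∘ (idm X ⊗ₘ lift g A)
    = mphi2 F Y (Y' ⊗ A) ∘ (idm (F Y) ⊗ₘ mphi2 F Y' A) ∘ (b ⊗ₘ (g ⊗ₘ idm (F A))).
  by rewrite /lift -!compA -!mtens_comp !compIl compIr.
rewrite -compA -massoc_nat compA -mphi2_assoc.
by rewrite /lift mtens_compr !compA.
Qed.

(** F I being isomorphic to I through phi_0, tensoring with it can be undone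
    by means of the right unitor. *)
Lemma lift_recover X Y (b : hom X (F Y)) :
  mrunit (F Y) ∘ (idm (F Y) ⊗ₘ (mphi0 F)^-1) ∘ (mphi2 F Y munit)^-1
    ∘ lift b munit ∘ (idm X ⊗ₘ mphi0 F) ∘ (mrunit X)^-1 = b.
Proof.
rewrite /lift !compA comp_invK -(compA (mrunit _ ∘ _)) mtens_swap.
rewrite compA -(compA (mrunit _)) -mtens_compl iso_invK mtens_id compIr.
by rewrite mrunit_nat comp_homK.
Qed.

Lemma lift_inj X Y (b b' : hom X (F Y)) : lift b munit = lift b' munit -> b = b'.
Proof. by move=> e; rewrite -(lift_recover b) e lift_recover. Qed.

End Lift.

(** * Naturality along the three basic generators *)

Section Generators.
Variables (C D : monoidal) (F : monoidal_functor C D).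
Variables (B : braided_coalgebra C) (B' : braided_coalgebra D).
Variable alpha : hom (bc B') (F (bc B)).
Implicit Types A : C.

Notation alpha2 := (mphi2 F (bc B) (bc B) ∘ (alpha ⊗ₘ alpha)).

Definition lift2 A :
    hom (bc B' ⊗ (bc B' ⊗ F A)) (F (bc B ⊗ (bc B ⊗ A))) :=
  lift alpha (bc B ⊗ A) ∘ (idm (bc B') ⊗ₘ lift alpha A).

Lemma lift2_assoc A : lift2 A ∘ massoc (bc B') (bc B') (F A)
  = fmap F (massoc (bc B) (bc B) A) ∘ lift alpha2 A.
Proof. exact: lift_assoc. Qed.

Lemma counit_lift A :
  d0 B' (F A) = fmap F (d0 B A) ∘ lift alpha A
  <-> lift (mphi0 F ∘ bcounit B') A = lift (fmap F (bcounit B) ∘ alpha) A.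
Proof.
have -> : d0 B' (F A) = fmap F (mlunit A) ∘ lift (mphi0 F ∘ bcounit B') A.
  by rewrite lift_precomp compA /d0 -(mphi2_lunit F A) /lift !compA.
rewrite /d0 fmapM -compA -lift_postcomp.
split=> [|-> //]; exact: (iso_monoE (i := iso_fmap F (mlunit A))).
Qed.

Lemma comul_lift A :
  lift2 A ∘ s0 B' (F A) = fmap F (s0 B A) ∘ lift alpha A
  <-> lift (alpha2 ∘ bcomul B') A = lift (fmap F (bcomul B) ∘ alpha) A.
Proof.
rewrite /s0 compA lift2_assoc -compA -lift_precomp.
rewrite fmapM -(compA (fmap F (massoc _ _ A))) -lift_postcomp.
split=> [|-> //]; exact: (iso_monoE (i := iso_fmap F (massoc _ _ A))).
Qed.

(** The endomorphisms are arbitrary, so that the lemma covers the braidings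
    and their inverses. *)
Lemma braid_lift (x : hom (bc B ⊗ bc B) (bc B ⊗ bc B))
    (x' : hom (bc B' ⊗ bc B') (bc B' ⊗ bc B')) A :
  lift2 A ∘ t0 x' (F A) = fmap F (t0 x A) ∘ lift2 A
  <-> lift (alpha2 ∘ x') A = lift (fmap F x ∘ alpha2) A.
Proof.
have eL : lift2 A ∘ t0 x' (F A) ∘ massoc _ _ (F A)
    = fmap F (massoc _ _ A) ∘ lift (alpha2 ∘ x') A.
  by rewrite -compA t0_assoc compA lift2_assoc (lift_precomp _ x') compA.
have eR : fmap F (t0 x A) ∘ lift2 A ∘ massoc _ _ (F A)
    = fmap F (massoc _ _ A) ∘ lift (fmap F x ∘ alpha2) A.
  rewrite -compA lift2_assoc compA -fmapM t0_assoc fmapM -compA.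
  by rewrite -lift_postcomp.
split=> e.
- apply: (iso_monoE (i := iso_fmap F (massoc _ _ A))).
  by rewrite /= -eL -eR e.
- by apply: (iso_epiE (i := massoc _ _ (F A))); rewrite eL eR e.
Qed.

End Generators.

(** * The relative morphism induced by a morphism of braided coalgebras *)

Section Extension.
Variables (C D : monoidal) (F : monoidal_functor C D).
Variables (B : braided_coalgebra C) (B' : braided_coalgebra D).
Variable alpha : hom (bc B') (F (bc B)).
Implicit Types A : C.

Notation alpha2 := (mphi2 F (bc B) (bc B) ∘ (alpha ⊗ₘ alpha)).

(** The only possible family with eta_1 = [lift alpha]: the recursion is forced
    by [relm_add] for m = 1. *)
Fixpoint liftn n A : hom (Tpow B' n (F A)) (F (Tpow B n A)) :=
  if n is n'.+1 then lift alpha (Tpow B n' A) ∘ (idm (bc B') ⊗ₘ liftn n' A)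
  else idm (F A).

Fact liftn_nat n A A' (f : hom A A') :
  liftn n A' ∘ fmap (Tpow B' n ⊚ F) f = fmap (F ⊚ Tpow B n) f ∘ liftn n A.
Proof.
elim: n => [|n IH] /=; first by rewrite compIl compIr.
by rewrite -compA -mtens_compl IH mtens_compl compA lift_nat compA.
Qed.

Definition liftn_trans n : Tpow B' n ⊚ F ⟹ F ⊚ Tpow B n :=
  @NatTrans C D (Tpow B' n ⊚ F) (F ⊚ Tpow B n) (liftn n) (@liftn_nat n).

Lemma liftnSS n A : liftn n.+2 A
  = lift2 alpha (Tpow B n A) ∘ (idm (bc B') ⊗ₘ (idm (bc B') ⊗ₘ liftn n A)).
Proof. by rewrite /lift2 /= mtens_compl !compA. Qed.

Lemma liftn_whisker m n A (f' : hom (Tpow B' m (F A)) (Tpow B' n (F A)))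
    (f : hom (Tpow B m A) (Tpow B n A)) :
  liftn n A ∘ f' = fmap F f ∘ liftn m A ->
  liftn n.+1 A ∘ (idm (bc B') ⊗ₘ f') = fmap F (idm (bc B) ⊗ₘ f) ∘ liftn m.+1 A.
Proof.
by move=> e; rewrite /= -compA -mtens_compl e mtens_compl compA lift_nat compA.
Qed.

Lemma liftn_add m n A :
  liftn (m + n) A ≡ liftn m (Tpow B n A) ∘ fmap (Tpow B' m) (liftn n A).
Proof.
elim: m => [|m IH] /=; first by rewrite compIl.
rewrite -compA -mtens_compl; apply: hom_eq_comp; last exact: hom_eq_tensl.
by rewrite Tpow_addE.
Qed.

Hypothesis alpha_counit : mphi0 F ∘ bcounit B' = fmap F (bcounit B) ∘ alpha.
Hypothesis alpha_comul : alpha2 ∘ bcomul B' = fmap F (bcomul B) ∘ alpha.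
Hypothesis alpha_braid :
  alpha2 ∘ bbraid B' = fmap F (bbraid B) ∘ mphi2 F (bc B) (bc B) ∘ (alpha ⊗ₘ alpha).

(** delta_j is delta_0 tensored with j strands on the left, where induction
    through [liftn_whisker] applies, and n - j strands on the right, which
    amounts to evaluating at a power of C applied to A.  The same reduction works
    for the other generators. *)
Lemma liftn_dlt j n A :
  liftn n A ∘ Tdlt B' j n (F A) = fmap F (Tdlt B j n A) ∘ liftn n.+1 A.
Proof.
have base k : liftn k A ∘ d0 B' (Tpow B' k (F A))
    = fmap F (d0 B (Tpow B k A)) ∘ liftn k.+1 A.
  rewrite -d0_nat /= compA; congr (_ ∘ _).
  by apply/counit_lift; rewrite alpha_counit.
elim: j n => [|j IH] [|n].
- exact: (base 0).
- exact: (base n.+1).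
- exact: (base 0).
- exact: (liftn_whisker (IH n)).
Qed.

Lemma liftn_sgm j n A :
  liftn n.+2 A ∘ Tsgm B' j n (F A) = fmap F (Tsgm B j n A) ∘ liftn n.+1 A.
Proof.
have base k : liftn k.+2 A ∘ s0 B' (Tpow B' k (F A))
    = fmap F (s0 B (Tpow B k A)) ∘ liftn k.+1 A.
  rewrite liftnSS -compA -s0_nat /= (compA (lift2 _ _)) (compA (fmap F _)).
  congr (_ ∘ _).
  by apply/comul_lift; rewrite alpha_comul.
elim: j n => [|j IH] [|n].
- exact: (base 0).
- exact: (base n.+1).
- exact: (base 0).
- exact: (liftn_whisker (IH n)).
Qed.

Lemma liftn_tau (x : hom (bc B ⊗ bc B) (bc B ⊗ bc B))
    (x' : hom (bc B' ⊗ bc B') (bc B' ⊗ bc B')) j n A :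
  alpha2 ∘ x' = fmap F x ∘ alpha2 ->
  liftn n.+1 A ∘ Ttau x' j n (F A) = fmap F (Ttau x j n A) ∘ liftn n.+1 A.
Proof.
move=> e.
have base k : liftn k.+2 A ∘ t0 x' (Tpow B' k (F A))
    = fmap F (t0 x (Tpow B k A)) ∘ liftn k.+2 A.
  rewrite liftnSS -compA -t0_nat (compA (lift2 _ _)) (compA (fmap F _)).
  congr (_ ∘ _).
  by apply/braid_lift; rewrite e.
elim: j n => [|j IH] [|n]; [|exact: (base n)| |exact: (liftn_whisker (IH n))];
  by rewrite /= fmapI compIl compIr.
Qed.

Lemma liftn_gen g A :
  liftn (gsrc g) A ∘ Tgen B' g (F A) = fmap F (Tgen B g A) ∘ liftn (gtgt g) A.
Proof.
have e : alpha2 ∘ bbraid B' = fmap F (bbraid B) ∘ alpha2.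
  by rewrite alpha_braid compA.
case: g => n j; [exact: liftn_dlt | exact: liftn_sgm | exact: liftn_tau |].
(* For an inverse crossing, the compatibility with the braiding is inverted. *)
by apply: liftn_tau; exact: (iso_intertwine_inv (j := iso_fmap F (bbraid B))).
Qed.

Lemma liftn_word m n w (h : wf m n w) A :
  liftn m A ∘ Tword B' h (F A) = fmap F (Tword B h A) ∘ liftn n A.
Proof.
elim: w n h => [|g w IH] n h.
  by have ? := wf_nilE h; subst n; rewrite /= !TcastE fmapI compIl compIr.
have ? := wf_consE h; subst n; rewrite /= !TcastE !compIr fmapM.
by rewrite compA IH -compA liftn_gen compA.
Qed.

Lemma liftn_relative : @relative_morphism C D (Ttilde B) (Ttilde B') F liftn_trans.
Proof.
split=> [m n f A|//|m n A]; last exact: liftn_add.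
elim/bcls_ind: f => w h.
change (liftn m A ∘ Tmor B' (bcls h) (F A)
  = fmap F (Tmor B (bcls h) A) ∘ liftn n A).
by rewrite !TmorE liftn_word.
Qed.

End Extension.

(** * Relative morphisms between the functors of braided coalgebras *)

Section Relative.
Variables (C D : monoidal) (F : monoidal_functor C D).
Variables (B : braided_coalgebra C) (B' : braided_coalgebra D).

Notation family :=
  (forall n : nat, stage (Ttilde B') n ⊚ F ⟹ F ⊚ stage (Ttilde B) n).
Implicit Types (eta theta : family) (alpha : hom (bc B') (F (bc B))).

Lemma relative_morphismS eta n A : relative_morphism eta ->
  eta n.+1 A = eta 1 (Tpow B n A) ∘ (idm (bc B') ⊗ₘ eta n A).
Proof. by case=> _ _ /(_ 1 n A)/hom_eqE. Qed.

Lemma relative_morphism_eq eta theta :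
  relative_morphism eta -> relative_morphism theta ->
  (forall A, eta 1 A = theta 1 A) -> eta = theta.
Proof.
move=> reta rtheta e1; apply: functional_extensionality_dep => n.
apply: nat_trans_eq => A; elim: n => [|n IH].
  by rewrite (hom_eqE (relm_unit reta A)) (hom_eqE (relm_unit rtheta A)).
by rewrite (relative_morphismS n _ reta) (relative_morphismS n _ rtheta) e1 IH.
Qed.

Lemma relative_morphism_gen eta g A : relative_morphism eta -> gvalid g ->
  eta (gsrc g) A ∘ Tgen B' g (F A) = fmap F (Tgen B g A) ∘ eta (gtgt g) A.
Proof.
move=> reta vg; rewrite -!(Tmor_gen _ vg).
exact: (relm_nat reta (bgen vg) A).
Qed.

(** One value of the naturality squares suffices, namely at I, since lifts are
    determined there. *)
Lemma relative_morphism_coalgebra eta alpha : relative_morphism eta ->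
  (forall A, eta 1 A = lift alpha A) ->
  [/\ mphi0 F ∘ bcounit B' = fmap F (bcounit B) ∘ alpha,
      mphi2 F (bc B) (bc B) ∘ (alpha ⊗ₘ alpha) ∘ bcomul B'
        = fmap F (bcomul B) ∘ alpha
    & mphi2 F (bc B) (bc B) ∘ (alpha ⊗ₘ alpha) ∘ bbraid B'
        = fmap F (bbraid B) ∘ mphi2 F (bc B) (bc B) ∘ (alpha ⊗ₘ alpha)].
Proof.
move=> reta e1.
have e2 A : eta 2 A = lift2 alpha A.
  by rewrite (relative_morphismS 1 _ reta) !e1.
split.
- apply/lift_inj/counit_lift; rewrite -e1.
  have := @relative_morphism_gen eta (dlt 0 0) munit reta isT.
  by rewrite (hom_eqE (relm_unit reta munit)) compIl.
- apply/lift_inj/comul_lift; rewrite -e1 -e2.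
  exact: (@relative_morphism_gen eta (sgm 0 0) munit reta isT).
- rewrite -(compA (fmap F _)); apply/lift_inj/braid_lift; rewrite -e2.
  exact: (@relative_morphism_gen eta (tau 1 1) munit reta isT).
Qed.

End Relative.

Theorem theorem1 (C D : monoidal)
    (B : braided_coalgebra C) (B' : braided_coalgebra D)
    (F : monoidal_functor C D) :
  set_bij
    [set eta : forall n : nat,
        stage (Ttilde B') n ⊚ F ⟹ F ⊚ stage (Ttilde B) n
      | relative_morphism eta /\
        exists alpha' : hom (bc B') (F (bc B)), forall A : C,
          eta 1 A = mphi2 F (bc B) A ∘ (alpha' ⊗ₘ idm (F A))]
    [set alpha : hom (bc B') (F (bc B))
      | [/\ mphi0 F ∘ bcounit B' = fmap F (bcounit B) ∘ alpha,
            mphi2 F (bc B) (bc B) ∘ (alpha ⊗ₘ alpha) ∘ bcomul B'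
              = fmap F (bcomul B) ∘ alpha
          & mphi2 F (bc B) (bc B) ∘ (alpha ⊗ₘ alpha) ∘ bbraid B'
              = fmap F (bbraid B) ∘ mphi2 F (bc B) (bc B) ∘ (alpha ⊗ₘ alpha)]]
    (fun eta =>
      mrunit (F (bc B)) ∘ (idm (F (bc B)) ⊗ₘ (mphi0 F)^-1)
        ∘ (mphi2 F (bc B) munit)^-1 ∘ eta 1 munit
        ∘ (idm (bc B') ⊗ₘ mphi0 F) ∘ (mrunit (bc B'))^-1).
Proof.
have recover (eta : forall n, stage (Ttilde B') n ⊚ F ⟹ F ⊚ stage (Ttilde B) n)
    alpha : (forall A, eta 1 A = lift alpha A) ->
    mrunit (F (bc B)) ∘ (idm (F (bc B)) ⊗ₘ (mphi0 F)^-1)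
      ∘ (mphi2 F (bc B) munit)^-1 ∘ eta 1 munit
      ∘ (idm (bc B') ⊗ₘ mphi0 F) ∘ (mrunit (bc B'))^-1 = alpha.
  by move=> ->; exact: lift_recover.
split=> [eta [reta [alpha e1]]|eta theta|alpha [hcounit hcomul hbraid]] /=.
- rewrite (recover _ _ e1); exact: (relative_morphism_coalgebra reta e1).
- move=> /set_mem[reta [alpha e1]] /set_mem[rtheta [beta f1]].
  rewrite (recover _ _ e1) (recover _ _ f1) => ab; subst beta.
  by apply: relative_morphism_eq => // A; rewrite e1 f1.
- have e1 A : liftn_trans alpha 1 A = lift alpha A.
    by rewrite /= mtens_id compIr.
  exists (liftn_trans alpha); last exact: (recover (liftn_trans alpha)).
  split; first exact: liftn_relative.
  by exists alpha.
Qed.
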